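(* Let $k\le n$ be positive integers and use the neglex term order on $\mathbb F[\mathbf x_n]$. The polynomials $h_k(x_1),h_k(x_1,x_2),\dots,h_k(x_1,\dots,x_n)$ together with the Demazure characters $\kappa_{\gamma(S)^*}(\mathbf x_n)$ for all $S\subseteq[n-1]$ with $|S|=n-k+1$ form a Gröbner basis of $J_{n,k}$. When $k<n$, this Gröbner basis is minimal.
   Context: $\mathbb F$ is a field, $\mathbb F[\mathbf x_n]=\mathbb F[x_1,\dots,x_n]$, $h_d$ denotes complete homogeneous and $e_d$ elementary symmetric polynomials; $J_{n,k}$ is the ideal generated by $h_k(x_1),\dots,h_k(x_1,\dots,x_n),e_n(\mathbf x_n),\dots,e_{n-k+1}(\mathbf x_n)$. Neglex is the lexicographic term order with $x_n>\cdots>x_1$. A Gröbner basis of $I$ is a finite subset $G\subseteq I$ whose leading monomials generate the initial ideal of $I$; it is minimal if all leading coefficients are $1$ and no leading monomial of one element divides that of another. The isobaric Demazure operator is $\pi_i(f)=\frac{x_if-x_{i+1}s_i(f)}{x_i-x_{i+1}}$, where $s_i$ swaps $x_i,x_{i+1}$. For a weak composition $\gamma=(\gamma_1,\dots,\gamma_n)$ (nonnegative integers), the Demazure character $\kappa_\gamma(\mathbf x_n)$ is defined recursively: $\kappa_\gamma=x_1^{\gamma_1}\cdots x_n^{\gamma_n}$ if $\gamma$ is weakly decreasing, and $\kappa_\gamma=\pi_i(\kappa_{s_i\gamma})$ if $\gamma_i<\gamma_{i+1}$, where $s_i\gamma$ swaps the entries in positions $i,i+1$. For $S=\{s_1<\cdots<s_m\}\subseteq[n]$,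 $\gamma(S)=(\gamma_1,\dots,\gamma_n)$ with $\gamma_{s_j}=s_j-j+1$ and $\gamma_i=0$ for $i\notin S$, and $\gamma(S)^*=(\gamma_n,\dots,\gamma_1)$ is its reversal. *)

(* Defs.v *)
From HB Require Import structures.
From mathcomp Require Import all_boot all_order all_algebra all_fingroup.
From mathcomp Require Import mpoly.
From Stdlib Require Import ClassicalEpsilon.

Set Implicit Arguments.
Unset Strict Implicit.
Unset Printing Implicit Defensive.

Import GRing.Theory.
Local Open Scope ring_scope.

Section Defs.
Context (R : fieldType) (n : nat).

(* Variables: x_(j+1) of the paper is 'X_j for j : 'I_n (0-based). *)

Definition hcomp (d j : nat) : {mpoly R[n]} :=
  \sum_(m : 'X_{1..n < d.+1} |
          (mdeg m == d) && [forall i : 'I_n, (j <= i)%N ==> (m i == 0%N)])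
    'X_[(m : 'X_{1..n})].

Definition esym (d : nat) : {mpoly R[n]} := mesym n R d.

Definition in_ideal (P : {mpoly R[n]} -> Prop) (p : {mpoly R[n]}) : Prop :=
  exists s : seq ({mpoly R[n]} * {mpoly R[n]}),
    (forall x, x \in s -> P x.2) /\ p = \sum_(x <- s) x.1 * x.2.

Definition in_ideal_seq (gs : seq {mpoly R[n]}) (p : {mpoly R[n]}) : Prop :=
  in_ideal (fun g => g \in gs) p.

Definition neglex_lt (m m' : 'X_{1..n}) : bool :=
  [exists i : 'I_n, (m i < m' i)%N &&
     [forall j : 'I_n, (i < j)%N ==> (m j == m' j)]].

Definition neglex_le (m m' : 'X_{1..n}) : bool := (m == m') || neglex_lt m m'.

Definition is_LM (p : {mpoly R[n]}) (m : 'X_{1..n}) : Prop :=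
  m \in msupp p /\ forall m', m' \in msupp p -> neglex_le m' m.

Definition initial_ideal (I : {mpoly R[n]} -> Prop) : {mpoly R[n]} -> Prop :=
  in_ideal (fun q => exists f m, I f /\ f != 0 /\ is_LM f m /\ q = 'X_[m]).

Definition LM_ideal (G : seq {mpoly R[n]}) : {mpoly R[n]} -> Prop :=
  in_ideal (fun q => exists g m, g \in G /\ g != 0 /\ is_LM g m /\ q = 'X_[m]).

Definition is_groebner (I : {mpoly R[n]} -> Prop) (G : seq {mpoly R[n]}) : Prop :=
  (forall g, g \in G -> I g) /\
  (forall p, initial_ideal I p <-> LM_ideal G p).

Definition mdivides (m m' : 'X_{1..n}) : bool := [forall i : 'I_n, (m i <= m' i)%N].

Definition is_minimal_groebner (I : {mpoly R[n]} -> Prop) (G : seq {mpoly R[n]})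
  : Prop :=
  is_groebner I G /\
  (forall g, g \in G -> g != 0 /\ forall m, is_LM g m -> g@_m = 1) /\
  (forall g g' m m', g \in G -> g' \in G -> g != g' ->
       is_LM g m -> is_LM g' m' -> ~~ mdivides m m').

(* isobaric divided difference pi_i for the adjacent pair of variables
   (x_i, x_j) = (x_i, x_{i+1}): the (exact) quotient
   (x_i f - x_{i+1} s_i(f)) / (x_i - x_{i+1}) *)
Definition pi_op (i j : 'I_n) (f : {mpoly R[n]}) : {mpoly R[n]} :=
  epsilon (inhabits 0)
    (fun q => ('X_i - 'X_j) * q = 'X_i * f - 'X_j * msym (tperm i j) f).

Definition mswap (i j : 'I_n) (g : 'X_{1..n}) : 'X_{1..n} :=
  [multinom g (tperm i j k) | k < n].

Definition ascent (g : 'X_{1..n}) : option ('I_n * 'I_n) :=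
  [pick ij : 'I_n * 'I_n | (val ij.2 == (val ij.1).+1) && (g ij.1 < g ij.2)%N].

Fixpoint demazure_rec (fuel : nat) (g : 'X_{1..n}) : {mpoly R[n]} :=
  match ascent g with
  | None => 'X_[g]
  | Some ij =>
      match fuel with
      | 0 => 0
      | f.+1 => pi_op ij.1 ij.2 (demazure_rec f (mswap ij.1 ij.2 g))
      end
  end.

(* Demazure character kappa_g; each step removes one inversion, so n*n
   steps suffice to reach a weakly decreasing composition *)
Definition demazure (g : 'X_{1..n}) : {mpoly R[n]} := demazure_rec (n * n) g.

(* gamma(S) for S a subset of [n] (0-based: element i stands for i+1):
   gamma_{s_j} = s_j - j + 1, i.e. (i+1) - #{t in S | t < i} *)
Definition gammaS (A : {set 'I_n}) : 'X_{1..n} :=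
  [multinom (if i \in A then i.+1 - #|[set t in A | (t < i)%N]| else 0)%N | i < n].

Definition mrev (g : 'X_{1..n}) : 'X_{1..n} := [multinom g (rev_ord i) | i < n].

Definition J_gens (k : nat) : seq {mpoly R[n]} :=
  [seq hcomp k j | j <- iota 1 n] ++ [seq esym d | d <- iota (n - k + 1) k].

Definition admissible_sets (k : nat) : seq {set 'I_n} :=
  enum [set A : {set 'I_n} | (#|A| == n - k + 1)%N &&
                              [forall i in A, (i.+1 < n)%N]].

Definition groebner_list (k : nat) : seq {mpoly R[n]} :=
  [seq hcomp k j | j <- iota 1 n] ++
  [seq demazure (mrev (gammaS A)) | A <- admissible_sets k].

End Defs.

(* Main.v *)
Require Import Defs.
From HB Require Import structures.
From mathcomp Require Import all_boot all_order all_algebra all_fingroup.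
From mathcomp Require Import mpoly.
From mathcomp Require Import ring zify.
From Stdlib Require Import ClassicalEpsilon.

(** The nonzero parts of gamma(S)^* decrease from left to right, so its Demazure
    character is the flagged Schur determinant det(h_(lam_a - a + b)(x_1..x_(p_a))),
    with p_a the positions of the nonzero parts: each pi_i only enlarges the
    alphabet of one row.  Here lam_a - a = k - p_a, and the coefficients of
    prod_i (1 - x_i t) give a vector with last entry 1 which the matrix maps into
    J_(n,k); hence the determinant lies in J_(n,k).  Its neglex leading term is the
    diagonal one.

    For the initial ideal, let alpha_1, alpha_2, ... be distinct scalars (available
    after extending F to F(t)) and let Y be the set of points with distinct
    coordinates z_i in {alpha_1..alpha_(k+i-1)} that use all of alpha_1..alpha_k.
    The generators of J_(n,k) are top-degree parts of polynomials vanishing on Y.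
    By induction on n, the monomials divisible by no proposed leading monomial are
    linearly independent as functions on Y, so none of them is the leading
    monomial of an element of J_(n,k). *)

Set Implicit Arguments.
Unset Strict Implicit.
Unset Printing Implicit Defensive.

Import GRing.Theory.
Local Open Scope ring_scope.

(** * Truncated generating series *)

Section TruncatedSeries.
Context (A : comNzRingType) (N : nat).
Implicit Types (p q : {poly A}) (x y : A).

(** Congruence modulo ['X^N], so that the polynomial [geom x] can stand for the power series 1/(1 -
    xt). *)
Definition eqm p q := forall d, (d < N)%N -> p`_d = q`_d.

Lemma eqmM p p' q q' : eqm p p' -> eqm q q' -> eqm (p * q) (p' * q').
Proof.
move=> hp hq d hd; rewrite !coefM; apply: eq_bigr => i _.
by rewrite hp ?hq //; have := ltn_ord i; lia.
Qed.

Lemma eqmB p p' q q' : eqm p p' -> eqm q q' -> eqm (p - q) (p' - q').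
Proof. by move=> hp hq d hd; rewrite !coefB hp ?hq. Qed.

Lemma eqmMl p q q' : eqm q q' -> eqm (p * q) (p * q').
Proof. exact: eqmM. Qed.

Definition lin x : {poly A} := 1 - x *: 'X.
Definition geom x : {poly A} := \poly_(l < N) x ^+ l.

Lemma lin_geom x : eqm (lin x * geom x) 1.
Proof.
have -> : lin x * geom x = 1 - (x *: 'X) ^+ N.
  rewrite -[RHS]opprB subrX1 -mulNr opprB /geom poly_def; congr (_ * _).
  by apply: eq_bigr => i _; rewrite exprZn.
by move=> d hd; rewrite coefB exprZn coefZ coefXn ltn_eqF // mulr0 subr0.
Qed.

Lemma size_prod_lin (I : Type) (r : seq I) (x : I -> A) :
  (size (\prod_(i <- r) lin (x i))%R <= (size r).+1)%N.
Proof.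
elim: r => [|i r IH]; first by rewrite big_nil size_polyC oner_neq0.
rewrite big_cons /=; apply: leq_trans (size_polyMleq _ _) _.
have : (size (lin (x i)) <= 2)%N.
  rewrite /lin; apply: leq_trans (size_polyD _ _) _.
  rewrite size_polyN geq_max size_polyC oner_neq0 /=.
  by apply: leq_trans (size_scale_leq _ _) _; rewrite size_polyX.
by move: (size _) (size _) IH => a b; lia.
Qed.

Lemma prod_lin_geom (I : Type) (r : seq I) (x : I -> A) :
  eqm (\prod_(i <- r) lin (x i) * \prod_(i <- r) geom (x i)) 1.
Proof.
rewrite -big_split /=; elim: r => [|i r IH]; first by rewrite big_nil.
rewrite big_cons -[X in eqm _ X]mulr1; apply: eqmM; [exact: lin_geom|exact: IH].
Qed.

Lemma lin_coef0 x : (lin x)`_0 = 1.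
Proof. by rewrite coefB coefZ coefX coef1 mulr0 subr0. Qed.

Lemma prod_lin_coef0 (I : Type) (r : seq I) (x : I -> A) :
  (\prod_(i <- r) lin (x i))`_0 = 1.
Proof.
elim: r => [|i r IH]; first by rewrite big_nil coef1.
by rewrite big_cons coef0M IH lin_coef0 mulr1.
Qed.

Lemma prod_geom_coef0 (I : Type) (r : seq I) (x : I -> A) : (0 < N)%N ->
  (\prod_(i <- r) geom (x i))`_0 = 1.
Proof.
move=> N0; elim: r => [|i r IH]; first by rewrite big_nil coef1.
by rewrite big_cons coef0M IH coef_poly N0 expr0 mulr1.
Qed.

(** Truncation of (x - y)/((1 - xt)(1 - yt)) = x/(1 - xt) - y/(1 - yt). A divided difference acts on
    a row of the flagged determinant through this identity. *)
Lemma geom_partial_fractions x y :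
  eqm ((x - y)%:P * (geom x * geom y)) (x%:P * geom x - y%:P * geom y).
Proof.
have -> : (x - y)%:P * (geom x * geom y) =
  x%:P * geom x * (lin y * geom y) - y%:P * geom y * (lin x * geom x).
  by rewrite /lin -!mul_polyC polyCB; ring.
rewrite -[X in eqm _ (X - _)]mulr1 -[X in eqm _ (_ - X)]mulr1.
by apply: eqmB; apply: eqmMl; apply: lin_geom.
Qed.

Context (x : nat -> A).
Definition eser (p : nat) : {poly A} := \prod_(0 <= i < p) lin (x i).
Definition hser (p : nat) : {poly A} := \prod_(0 <= i < p) geom (x i).

(** The common factors cancel and leave a polynomial of degree at most j - p. Its vanishing higher
    coefficients give the triangularity in [flag_det_base] and the relation behind
    [flag_det_in_ideal]. *)
Lemma eser_hser_ge (p : nat) j : (p <= j)%N ->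
  eqm (eser j * hser p) (\prod_(p <= i < j) lin (x i)).
Proof.
move=> pj; rewrite /eser (big_cat_nat (leq0n _) pj) //= mulrAC -[X in eqm _ X]mul1r.
by apply: eqmM => //; apply: prod_lin_geom.
Qed.

Lemma eser_hser_le (p : nat) j : (j <= p)%N ->
  eqm (eser j * hser p) (\prod_(j <= i < p) geom (x i)).
Proof.
move=> pj; rewrite /hser (big_cat_nat (leq0n _) pj) //= mulrA -[X in eqm _ X]mul1r.
by apply: eqmM => //; apply: prod_lin_geom.
Qed.

Lemma hserS (p : nat) : hser p.+1 = hser p * geom (x p).
Proof. by rewrite /hser big_nat_recr. Qed.

Lemma hser_coefS (p : nat) d : (d.+1 < N)%N ->
  (hser p.+1)`_d.+1 = (hser p)`_d.+1 + x p * (hser p.+1)`_d.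
Proof.
move=> hd; have : eqm (lin (x p) * hser p.+1) (hser p).
  rewrite hserS mulrCA -[X in eqm _ X]mulr1; apply: eqmMl; exact: lin_geom.
move/(_ _ hd); rewrite /lin mulrBl mul1r coefB -scalerAl coefZ coefXM /=.
by move=> <-; rewrite subrK.
Qed.

Lemma size_eser (p : nat) : (size (eser p) <= p.+1)%N.
Proof.
by apply: leq_trans (size_prod_lin _ _) _; rewrite size_iota subn0.
Qed.

Lemma eser_coef0 (p : nat) : (eser p)`_0 = 1.
Proof. exact: prod_lin_coef0. Qed.

End TruncatedSeries.

Section MapSeries.
Context (A B : comNzRingType) (N : nat) (f : {rmorphism A -> B}).

Lemma map_lin x : map_poly f (lin x) = lin (f x).
Proof. by rewrite /lin rmorphB rmorph1 /= linearZ /= map_polyX. Qed.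

Lemma map_geom x : map_poly f (geom N x) = geom N (f x).
Proof.
apply/polyP => d; rewrite coef_map /= /geom !coef_poly.
by rewrite (fun_if f) rmorphXn rmorph0.
Qed.

Lemma map_eser x p : map_poly f (eser x p) = eser (f \o x) p.
Proof. by rewrite rmorph_prod; apply: eq_bigr => i _; apply: map_lin. Qed.

Lemma map_hser x p : map_poly f (hser N x p) = hser N (f \o x) p.
Proof. by rewrite rmorph_prod; apply: eq_bigr => i _; apply: map_geom. Qed.

End MapSeries.

(** * Symmetric polynomials as coefficients of the series *)

Section Variables.
Context (R : fieldType) (n : nat).
Local Notation A := {mpoly R[n]}.

(* The value 0 beyond the last variable makes lin and geom trivial there. *)
Definition xvar (i : nat) : A := oapp (fun o : 'I_n => 'X_o) 0 (insub i).

Lemma xvarE (o : 'I_n) : xvar o = 'X_o.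
Proof. by rewrite /xvar valK. Qed.

Lemma mcoeff_hcomp d j m : (hcomp R n d j)@_m =
  ((mdeg m == d) && [forall i : 'I_n, (j <= i)%N ==> (m i == 0%N)])%:R.
Proof.
rewrite /hcomp raddf_sum /=.
case: (boolP (_ && _)) => [/andP[/eqP hm hf]|hN].
  have hm' : (mdeg m < d.+1)%N by rewrite hm.
  rewrite (bigD1 (BMultinom hm')) /= ?hm ?eqxx // mcoeffX eqxx.
  rewrite big1 ?addr0 // => m' /andP[_ ne]; rewrite mcoeffX.
  by case: eqP => // e; case/eqP: ne; apply: val_inj.
rewrite big1 // => m' hm'; rewrite mcoeffX; case: eqP => // e.
by rewrite -e hm' in hN.
Qed.

Lemma hcomp0 j : hcomp R n 0 j = 1.
Proof.
apply/mpolyP => m; rewrite mcoeff_hcomp mcoeff1 mdeg_eq0.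
case: eqP => //= ->; case: forallP => // h; case: h => i; rewrite mnm0E.
by rewrite eqxx implybT.
Qed.

Lemma hcompS0 d : hcomp R n d.+1 0 = 0.
Proof.
apply/mpolyP => m; rewrite mcoeff_hcomp mcoeff0.
case: eqP => //= hm; case: forallP => // h; move: hm; rewrite mdegE big1 // => i _.
by apply/eqP; have := h i.
Qed.

(** A monomial in x_0..x_j either avoids x_j or is x_j times a monomial of one degree less.
    [hser_coefS] is the same recurrence for the series, whence [hcompE]. *)
Lemma hcompSS d (j : 'I_n) :
  hcomp R n d.+1 j.+1 = hcomp R n d.+1 j + 'X_j * hcomp R n d j.+1.
Proof.
apply/mpolyP => m; rewrite mcoeffD !mcoeff_hcomp mulrC.
case: (posnP (m j)) => hj.
  have -> : (hcomp R n d j.+1 * 'X_j)@_m = 0 :> R.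
    apply/memN_msupp_eq0; rewrite (perm_mem (msuppMX _ _)).
    apply/mapP => -[m' _] /mnmP/(_ j); rewrite mnmDE mnm1E eqxx hj; lia.
  rewrite addr0; congr (_ && _)%:R; apply/forallP/forallP => h i.
    apply/implyP; rewrite leq_eqVlt => /orP[/eqP/val_inj <-|hi]; first exact/eqP.
    exact: (implyP (h i)).
  by apply/implyP => hi; apply: (implyP (h i)); apply: ltnW.
have em : m = (U_(j) + (m - U_(j)))%MM.
  apply/mnmP => i; rewrite mnmDE mnmBE mnm1E; case: eqP => [<-|]; lia.
have -> : (hcomp R n d j.+1 * 'X_j)@_m = (hcomp R n d j.+1)@_(m - U_(j)).
  by rewrite {1}em mcoeffMX.
rewrite mcoeff_hcomp.
have -> : [forall i : 'I_n, (j <= i)%N ==> (m i == 0%N)] = false.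
  by apply/negP => /forallP/(_ j); rewrite leqnn; lia.
rewrite andbF add0r {1}em mdegD mdeg1 add1n eqSS; congr (_ && _)%:R.
apply: eq_forallb => i; rewrite mnmBE mnm1E; case: (j =P i) => [<-|_]; first by rewrite ltnn.
by rewrite subn0.
Qed.

Lemma hcompE N d j : (d < N)%N -> (j <= n)%N ->
  hcomp R n d j = (hser N xvar j)`_d.
Proof.
elim: j d => [|j IHj] d.
  move=> _ _; rewrite /hser big_geq // coef1; case: d => [|d].
    by rewrite hcomp0.
  by rewrite hcompS0.
elim: d => [|d IHd] hd hj; first by rewrite hcomp0 prod_geom_coef0.
rewrite hser_coefS // -IHj // 1?ltnW // -IHd // 1?ltnW //.
by rewrite (hcompSS d (Ordinal hj)) -xvarE.
Qed.

Lemma eserE d : (eser xvar n)`_d = (-1) ^+ d * Defs.esym R n d.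
Proof.
rewrite /eser big_mkord /Defs.esym mesymE mulr_sumr.
under eq_bigr => i _ do rewrite xvarE /lin addrC.
rewrite bigA_distr /= coef_sum (bigID (fun h : {set 'I_n} => #|h| == d)) /=.
have e (h : {set 'I_n}) : \prod_i (if i \in h then - ('X_i *: 'X) else 1) =
    ((-1) ^+ #|h| * 'X_[mesym1 h]) *: 'X^#|h| :> {poly A}.
  rewrite -big_mkcond /= prodrN; under eq_bigr do rewrite -mul_polyC.
  rewrite big_split /= prodr_const -rmorph_prod /= mul_polyC.
  rewrite -[RHS]mul_polyC rmorphM rmorphXn rmorphN1 /= -mulrA mul_polyC.
  congr (_ * (_ *: _)); rewrite mpolyXE_id big_mkcond /=; apply: eq_bigr => i _.
  by rewrite mnmE; case: (i \in h).
rewrite [X in _ + X]big1 ?addr0 => [|h hd]; last first.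
  by rewrite e coefZ coefXn eq_sym (negPf hd) mulr0.
apply: eq_bigr => h /eqP <-; by rewrite e coefZ coefXn eqxx mulr1.
Qed.

End Variables.

(** * Leading terms *)

Section Neglex.
Context (n : nat).
Implicit Types m : 'X_{1..n}.

Lemma neglex_ltP m m' : reflect
  (exists2 i : 'I_n, (m i < m' i)%N & forall j : 'I_n, (i < j)%N -> m j = m' j)
  (neglex_lt m m').
Proof.
apply: (iffP existsP) => [[i /andP[h /forallP hf]]|[i h hf]]; exists i => //.
  by move=> j ij; apply/eqP; apply: (implyP (hf j)).
by rewrite h; apply/forallP => j; apply/implyP => /hf ->.
Qed.

Lemma neglex_ltnn m : neglex_lt m m = false.
Proof. by apply/idP => /neglex_ltP[i]; rewrite ltnn. Qed.

Lemma neglex_lt_trans m2 m1 m3 :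
  neglex_lt m1 m2 -> neglex_lt m2 m3 -> neglex_lt m1 m3.
Proof.
move=> /neglex_ltP[i h hi] /neglex_ltP[j h' hj]; apply/neglex_ltP.
case: (ltngtP i j) => [ij|ji|/val_inj ij].
- exists j => [|q jq]; first by rewrite hi.
  by rewrite hi ?hj //; apply: ltn_trans jq.
- exists i => [|q iq]; first by rewrite -hj.
  by rewrite hi ?hj //; apply: ltn_trans iq.
- subst j; exists i => [|q iq]; first exact: ltn_trans h'.
  by rewrite hi ?hj.
Qed.

Lemma neglex_le_lt_trans m2 m1 m3 :
  neglex_le m1 m2 -> neglex_lt m2 m3 -> neglex_lt m1 m3.
Proof. by case/orP => [/eqP -> //|]; apply: neglex_lt_trans. Qed.

Lemma neglex_le_anti m m' : neglex_le m m' -> neglex_le m' m -> m = m'.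
Proof.
case/orP => [/eqP //|h] h'.
by have := neglex_le_lt_trans h' h; rewrite neglex_ltnn.
Qed.

Lemma neglex_lt_add m m1 m2 : neglex_lt m1 m2 -> neglex_lt (m1 + m) (m2 + m).
Proof.
move=> /neglex_ltP[i h hi]; apply/neglex_ltP; exists i => [|j ij].
  by rewrite !mnmDE ltn_add2r.
by rewrite !mnmDE hi.
Qed.

Lemma neglex_ltD m1 m2 m3 m4 : neglex_lt m1 m2 -> neglex_le m3 m4 ->
  neglex_lt (m1 + m3) (m2 + m4).
Proof.
move=> h /orP[/eqP ->|h']; first exact: neglex_lt_add.
apply: (@neglex_lt_trans (m2 + m3)); first exact: neglex_lt_add.
by rewrite addmC [X in neglex_lt _ X]addmC; apply: neglex_lt_add.
Qed.

Lemma neglex_leD m1 m2 m3 m4 : neglex_le m1 m2 -> neglex_le m3 m4 ->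
  neglex_le (m1 + m3) (m2 + m4).
Proof.
case/orP => [/eqP ->|h] h'; last by rewrite /neglex_le neglex_ltD ?orbT.
case/orP: h' => [/eqP ->|h']; first by rewrite /neglex_le eqxx.
by rewrite addmC [X in neglex_le _ X]addmC /neglex_le neglex_lt_add ?orbT.
Qed.

(** Finitely many monomials have degree at most d, so the induction can run on the number of those
    below [m]. *)
Lemma neglex_ind d (P : 'X_{1..n} -> Prop) :
  (forall m, mdeg m = d ->
     (forall m', mdeg m' = d -> neglex_lt m' m -> P m') -> P m) ->
  forall m, mdeg m = d -> P m.
Proof.
move=> IH.
pose below m := [set b : 'X_{1..n < d.+1} | neglex_lt b m].
suff H c m : (#|below m| < c)%N -> mdeg m = d -> P m.
  by move=> m; apply: (H _ m (ltnSn _)).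
elim: c m => // c IHc m hc hm; apply: IH => // m' hm' lt; apply: IHc (hm').
apply: leq_trans (hc : #|below m| <= c)%N; apply: proper_card; apply/properP; split.
  by apply/subsetP => b; rewrite !inE => /neglex_lt_trans; apply.
have hb : (mdeg m' < d.+1)%N by rewrite hm'.
by exists (BMultinom hb); rewrite !inE // neglex_ltnn.
Qed.

End Neglex.

Section Leading.
Context (R : fieldType) (n : nat).
Implicit Types (p q : {mpoly R[n]}) (m : 'X_{1..n}).

(* [c] may vanish, so [m] only bounds the support from above. *)
Definition lead p m (c : R) :=
  p@_m = c /\ forall m', m' \in msupp p -> neglex_le m' m.

Lemma lead_is_LM p m : lead p m 1 -> is_LM p m.
Proof. by case=> h1 h2; split => //; rewrite mcoeff_msupp h1 oner_neq0. Qed.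

Lemma is_LM_inj p m m' : is_LM p m -> is_LM p m' -> m = m'.
Proof. by move=> [h1 h2] [h3 h4]; apply: neglex_le_anti; auto. Qed.

Lemma lead_neq0 p m : lead p m 1 -> p != 0.
Proof. by case=> h _; apply: contra_eq_neq h => ->; rewrite mcoeff0 eq_sym oner_neq0. Qed.

Lemma lead1 : lead 1 0%MM 1.
Proof. by split=> [|m]; rewrite ?mcoeff1 ?eqxx // msupp1 inE /neglex_le => ->. Qed.

Lemma leadX m : lead 'X_[m] m 1.
Proof.
by split=> [|m']; rewrite ?mcoeffX ?eqxx // msuppX inE /neglex_le => ->.
Qed.

Lemma leadM p q m m' c c' :
  lead p m c -> lead q m' c' -> lead (p * q) (m + m')%MM (c * c').
Proof.
move=> [hp hp'] [hq hq']; split; last first.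
  move=> u /msuppM_le/allpairsP[[a b] /= [ha hb ->]].
  by apply: neglex_leD; auto.
(* The order is strictly compatible with addition, so the exponent m + m' arises from the pair (m,
   m') only. *)
have tail a b : a \in msupp p -> b \in msupp q -> (a, b) != (m, m') ->
    (a + b)%MM != (m + m')%MM.
  move=> ha hb ne; apply: contraNneq ne => e.
  case/orP: (hp' _ ha) => [/eqP ea|la].
    by rewrite ea in e *; rewrite (addmI e).
  by have := neglex_ltD la (hq' _ hb); rewrite e neglex_ltnn.
rewrite {1}[p]mpolyE {1}[q]mpolyE big_distrlr /= raddf_sum /=.
under eq_bigr do rewrite raddf_sum /=.
under eq_bigr do under eq_bigr do
  rewrite -scalerAl -scalerAr scalerA -mpolyXD mcoeffZ mcoeffX.
have zero a b : a \in msupp p -> b \in msupp q -> (a, b) != (m, m') ->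
   p@_a * q@_b * ((a + b)%MM == (m + m')%MM)%:R = 0.
  by move=> ha hb ne; rewrite (negPf (tail _ _ ha hb ne)) mulr0.
(* Since [c] may be 0, [m] need not lie in the support; then no pair contributes and both sides
   vanish. *)
have [mp|mp] := boolP (m \in msupp p); last first.
  rewrite -hp (memN_msupp_eq0 mp) mul0r big_seq big1 // => a ha.
  rewrite big_seq big1 // => b hb; apply: zero => //.
  by apply: contraNneq mp => -[<-].
have [mq|mq] := boolP (m' \in msupp q); last first.
  rewrite -hq (memN_msupp_eq0 mq) mulr0 big_seq big1 // => a ha.
  rewrite big_seq big1 // => b hb; apply: zero => //.
  by apply: contraNneq mq => -[_ <-].
rewrite (bigD1_seq m) ?msupp_uniq //= (bigD1_seq m') ?msupp_uniq //= eqxx mulr1.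
rewrite big_seq_cond big1 ?addr0 => [|b /andP[hb ne]]; last first.
  by apply: zero => //; apply: contraNneq ne => -[->].
rewrite hp hq big_seq_cond big1 ?addr0 // => a /andP[ha ne].
rewrite big_seq big1 // => b hb; apply: zero => //.
by apply: contraNneq ne => -[->].
Qed.

Lemma lead_prod (I : Type) (r : seq I) (F : I -> {mpoly R[n]}) (M : I -> 'X_{1..n})
    (c : I -> R) :
  (forall i, lead (F i) (M i) (c i)) ->
  lead (\prod_(i <- r) F i) (\sum_(i <- r) M i)%MM (\prod_(i <- r) c i).
Proof.
move=> h; elim: r => [|i r IH]; first by rewrite !big_nil; apply: lead1.
by rewrite !big_cons; apply: leadM.
Qed.

Lemma leadD0 p q m c : lead p m c ->
  (forall m', m' \in msupp q -> neglex_lt m' m) -> lead (p + q) m c.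
Proof.
move=> [h1 h2] h; split.
  rewrite mcoeffD h1 [q@_m]memN_msupp_eq0 ?addr0 //.
  by apply/negP => /h; rewrite neglex_ltnn.
move=> m' /msuppD_le; rewrite mem_cat => /orP[/h2 //|/h].
by rewrite /neglex_le => ->; rewrite orbT.
Qed.

Lemma lead_hcomp d (j : 'I_n) : lead (hcomp R n d j.+1) (U_(j) *+ d)%MM 1.
Proof.
split.
  rewrite mcoeff_hcomp mdegMn mdeg1 mul1n eqxx /=.
  case: forallP => // h; case: h => i; apply/implyP => ij.
  by rewrite mulmnE mnm1E (_ : (j == i) = false) //; apply/eqP => e; rewrite e ltnn in ij.
move=> m; rewrite mcoeff_msupp mcoeff_hcomp.
case: (boolP (_ && _)) => [/andP[/eqP hm /forallP hf] _|]; last by rewrite eqxx.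
have z (i : 'I_n) : (j < i)%N -> m i = 0%N by move=> ij; apply/eqP/(implyP (hf i)).
have uE (i : 'I_n) : (U_(j) *+ d)%MM i = ((j == i) * d)%N by rewrite mulmnE mnm1E.
have := hm; rewrite mdegE (bigD1 j) //=; set S := (\big[_/_]_(_ <- _ | _) _)%N => hd.
case: (ltnP (m j) d) => hj.
  apply/orP; right; apply/neglex_ltP; exists j => [|i ij].
    by rewrite uE eqxx mul1n.
  by rewrite z // uE (_ : (j == i) = false) //; apply/eqP => e; rewrite e ltnn in ij.
have hs : S = 0%N by lia.
apply/orP; left; apply/eqP/mnmP => i; rewrite uE.
case: (j =P i) => [<-|ne]; first by rewrite mul1n; lia.
by move/eqP: hs; rewrite /S sum_nat_eq0 => /forallP/(_ i)/implyP h; apply/eqP/h/eqP => e; case: ne.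
Qed.

End Leading.

(** * Demazure characters as flagged determinants *)

Section DetLemmas.
Context (A : comNzRingType) (m : nat).

(** Linearity in row [a]: it lifts a divided-difference identity from one row to the whole
    determinant. *)
Lemma det_row_comb (a : 'I_m) (M M1 M2 : 'M[A]_m) (u v w : A) :
  (forall b c, b != a -> M1 b c = M b c) -> (forall b c, b != a -> M2 b c = M b c) ->
  (forall c, u * M a c = v * M1 a c - w * M2 a c) ->
  u * \det M = v * \det M1 - w * \det M2.
Proof.
move=> h1 h2 h; rewrite !(expand_det_row _ a) !mulr_sumr -sumrB.
apply: eq_bigr => c _.
have cofE (M' : 'M[A]_m) : (forall b c, b != a -> M' b c = M b c) ->
    cofactor M' a c = cofactor M a c.
  move=> h'; rewrite /cofactor; congr (_ * \det _); apply/matrixP => i j.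
  by rewrite !mxE h' // eq_sym neq_lift.
by rewrite (cofE _ h1) (cofE _ h2) mulrA h mulrBl !mulrA.
Qed.

End DetLemmas.

Section DemazureDet.
Context (R : fieldType) (n : nat).
Local Notation A := {mpoly R[n]}.
Local Notation x := (@xvar R n).

Lemma msymXU (s : 'S_n) (o : 'I_n) : msym s ('X_o : A) = 'X_(s o).
Proof.
rewrite msymX; congr 'X_[_]; apply/mnmP => i.
by rewrite mnmE !mnm1E -(inj_eq (@perm_inj _ s)) permKV.
Qed.

Lemma mpolyXU_inj : injective (fun o : 'I_n => 'X_o : A).
Proof.
move=> i j /(congr1 (mcoeff U_(i))); rewrite !mcoeffXU eqxx.
by case: (j =P i) => // _ /eqP; rewrite oner_eq0.
Qed.

(** [pi_op] chooses its quotient by [epsilon]; since ['X_i - 'X_j] can be cancelled, exhibiting one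
    quotient identifies the value. *)
Lemma pi_opE (i j : 'I_n) (f q : A) : i != j ->
  ('X_i - 'X_j) * q = 'X_i * f - 'X_j * msym (tperm i j) f -> pi_op i j f = q.
Proof.
move=> ij h; rewrite /pi_op; set P := fun _ => _.
have nz : 'X_i - 'X_j != 0 :> A by rewrite subr_eq0 (inj_eq mpolyXU_inj).
apply: (mulfI nz); rewrite h.
exact: (epsilon_spec (inhabits 0) P (ex_intro _ q h)).
Qed.

Lemma msym_xvar_out (i j : 'I_n) r : r != i :> nat -> r != j :> nat ->
  msym (tperm i j) (x r) = x r.
Proof.
rewrite /xvar; case: insubP => [o _ <-|_] /=; last by rewrite msym0.
by move=> oi oj; rewrite msymXU tpermD // eq_sym.
Qed.

(** The first q variables contain both or neither of x_i and x_(i+1), so the series is symmetric in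
    these two. *)
Lemma msym_hser N (i j : 'I_n) (q : nat) : j = i.+1 :> nat -> q != i.+1 ->
  map_poly (msym (tperm i j)) (hser N x q) = hser N x q.
Proof.
move=> hj hq; rewrite map_hser /hser.
case: (ltngtP q i.+1) hq => // hq _.
  apply: eq_big_nat => r /andP[_ hr] /=; rewrite msym_xvar_out //=; lia.
have e (y : nat -> A) : \prod_(0 <= r < q) geom N (y r) =
   (\prod_(0 <= r < i) geom N (y r)) * (geom N (y i) * (geom N (y i.+1) *
     \prod_(i.+2 <= r < q) geom N (y r))).
  rewrite (@big_cat_nat _ _ _ i 0 q) //=; last by lia.
  congr (_ * _); rewrite big_ltn ?(ltnW hq) //; congr (_ * _).
  by rewrite big_ltn.
rewrite !e /=; congr (_ * _).
  apply: eq_big_nat => r /andP[_ hr] /=; rewrite msym_xvar_out //; lia.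
rewrite -hj !xvarE !msymXU tpermL tpermR mulrCA; congr (_ * (_ * _)).
apply: eq_big_nat => r /andP[hr _] /=; rewrite msym_xvar_out //; lia.
Qed.

Context (m N : nat) (lam : 'I_m -> nat).
Hypothesis lam_gt0 : forall a, (0 < lam a)%N.
Hypothesis lam_dec : forall a b : 'I_m, (a <= b)%N -> (lam b <= lam a)%N.
Hypothesis lamN : forall a b : 'I_m, (lam a + b < N)%N.

(* [('X^a * H)`_(lam a + b)] is h_(lam a - a + b), with value 0 when the index
   is negative. *)
Definition flag_mx (p : 'I_m -> 'I_n) : 'M[A]_m :=
  \matrix_(a, b) ('X^a * hser N x (p a).+1)`_(lam a + b).

(** All rows except [a] are symmetric in the two variables, so [pi_op] acts on row [a] alone and
    lengthens its alphabet from x_0..x_i to x_0..x_j. *)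
Lemma flag_det_step (i j : 'I_n) (p p' : 'I_m -> 'I_n) (a : 'I_m) :
  j = i.+1 :> nat -> p a = j -> p' a = i ->
  (forall b, b != a -> [/\ p' b = p b, p b != i & p b != j]) ->
  pi_op i j (\det (flag_mx p')) = \det (flag_mx p).
Proof.
move=> hj pa p'a hp; apply: pi_opE.
  by apply/eqP => e; move: hj; rewrite e /=; lia.
rewrite -det_map_mx /=; apply: (det_row_comb (a := a)).
- by move=> b c /hp[e _ _]; rewrite !mxE e.
- move=> b c /hp[e ni nj]; rewrite !mxE e -coef_map rmorphM /= map_polyXn.
  by rewrite msym_hser // eqSS.
move=> c; rewrite !mxE pa p'a hj -coef_map rmorphM /= map_polyXn.
rewrite !hserS rmorphM /= msym_hser //; last by lia.
rewrite map_geom /= -hj !xvarE msymXU tpermL -!coefCM -coefB.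
set u := mpolyX R U_(i); set v := mpolyX R U_(j).
have -> : (u - v)%:P * ('X^a * (hser N x i * geom N u * geom N v)) =
    'X^a * hser N x i * ((u - v)%:P * (geom N u * geom N v)) by ring.
have -> : u%:P * ('X^a * (hser N x i * geom N u)) -
      v%:P * ('X^a * (hser N x i * geom N v)) =
    'X^a * hser N x i * (u%:P * geom N u - v%:P * geom N v) by ring.
by apply: eqmMl (lamN _ _); apply: geom_partial_fractions.
Qed.

(* Right multiplication by the unitriangular matrix of coefficients of the
   partial products of the 1 - x_i t makes the matrix triangular. *)
Lemma flag_det_base (p : 'I_m -> 'I_n) : (forall a, p a = a :> nat) ->
  \det (flag_mx p) = \prod_a 'X_(p a) ^+ lam a.
Proof.
move=> hp.
pose U : 'M[A]_m := \matrix_(l, j) if (l <= j)%N then (eser x j)`_(j - l) else 0.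
have detU : \det U = 1.
  rewrite -det_tr det_trig; last first.
    by apply/is_trig_mxP => a b ab; rewrite !mxE leqNgt ab.
  by rewrite big1 // => a _; rewrite !mxE leqnn subnn eser_coef0.
rewrite -[LHS]mulr1 -[in LHS]detU -det_mulmx.
have UE (a b : 'I_m) : (flag_mx p *m U) a b =
    ('X^a * (eser x b * hser N x a.+1))`_(lam a + b).
  rewrite mxE mulrCA coefM.
  pose F l := ('X^a * hser N x a.+1)`_(lam a + l) *
    (if (l <= b)%N then (eser x b)`_(b - l) else 0).
  transitivity (\sum_(0 <= l < m) F l).
    by rewrite big_mkord; apply: eq_bigr => l _; rewrite !mxE hp.
  rewrite (@big_cat_nat _ _ _ b.+1) //= [X in _ + X]big1_seq ?addr0; last first.
    move=> l /andP[_]; rewrite mem_index_iota => /andP[bl _].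
    by rewrite /F leqNgt bl mulr0.
  rewrite -(big_mkord xpredT (fun l => (eser x b)`_l * ('X^a * hser N x a.+1)`_(lam a + b - l))).
  rewrite [RHS](@big_cat_nat _ _ _ b.+1) //=; last by rewrite ltnS leq_addl.
  rewrite [X in _ = _ + X]big1_seq ?addr0; last first.
    move=> l /andP[_]; rewrite mem_index_iota => /andP[bl _].
    by rewrite [(eser x b)`_l]nth_default ?mul0r //; apply: leq_trans (size_eser _ _) _.
  rewrite big_nat_rev /=; apply: eq_big_nat => l /andP[_ hl].
  rewrite /F add0n subSS leq_subr mulrC; congr (_`__ * _`__); lia.
rewrite det_trig; last first.
  apply/is_trig_mxP => a b ab; rewrite UE.
  (* Above the diagonal the entry is the coefficient of index lam a + b in a polynomial of degree
     less than b. *)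
  rewrite (eqmMl _ (eser_hser_ge x ab)) // nth_default //.
  apply: leq_trans (size_polyMleq _ _) _; rewrite size_polyXn.
  have := size_prod_lin (index_iota a.+1 b) x; rewrite size_iota.
  have := lam_gt0 a; move: (size _); lia.
apply: eq_bigr => a _; rewrite UE (eqmMl _ (eser_hser_le x (leqnSn a))) //.
rewrite big_nat1 coefXnM ltnNge leq_addl /= addnK coef_poly.
by rewrite (leq_ltn_trans _ (lamN a a)) ?leq_addr // -[in x a]hp xvarE.
Qed.

(** Describes the compositions met in the recursion: the nonzero parts [lam] keep their order, and
    only their positions [p] change. *)
Definition placed (p : 'I_m -> 'I_n) (g : 'X_{1..n}) :=
  [/\ (forall a b : 'I_m, (a < b)%N -> (p a < p b)%N), (forall a, g (p a) = lam a)
    & forall i, (forall a, p a != i) -> g i = 0%N].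

Lemma placed_inj p g : placed p g -> injective p.
Proof.
case=> h _ _ a b e; apply: val_inj; case: (ltngtP a b) => // /h.
  by rewrite e ltnn.
by rewrite e ltnn.
Qed.

Lemma placed_codom p g i : placed p g -> (0 < g i)%N -> exists a, p a = i.
Proof.
case=> _ _ h hi; case: (pickP (fun a => p a == i)) => [a /eqP <-|H]; first by exists a.
by rewrite h // in hi => a; rewrite H.
Qed.

(** In a weakly decreasing composition no zero precedes a positive entry, so the positions fill an
    initial segment. *)
Lemma placed_sorted p g : placed p g ->
  (forall i j : 'I_n, j = i.+1 :> nat -> (g j <= g i)%N) -> forall a, p a = a :> nat.
Proof.
move=> pl hg; case: (pl) => hp pg _.
have down d (i j : 'I_n) : j = (i + d)%N :> nat -> (g j <= g i)%N.
  elim: d j => [|d IH] j; first by rewrite addn0 => /val_inj ->.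
  move=> hj; have hd : (i + d < n)%N by have := ltn_ord j; lia.
  apply: leq_trans (IH (Ordinal hd) _) => //; apply: hg; rewrite /=; lia.
have ge_a c (a : 'I_m) : a = c :> nat -> (c <= p a)%N.
  elim: c a => // c IH a ha; have hc : (c < m)%N by have := ltn_ord a; lia.
  have := IH (Ordinal hc) erefl; have := hp (Ordinal hc) a; rewrite ha /= ltnSn.
  by move=> /(_ isT) h1 h2; apply: leq_trans h1.
suff H c (a : 'I_m) : (a < c)%N -> p a = a :> nat by move=> a; apply: (H a.+1).
elim: c a => // c IH a ac.
have := ge_a _ a erefl; rewrite leq_eqVlt => /orP[/eqP -> //|lt].
have ha : (a < n)%N by apply: ltn_trans lt _.
have : (0 < g (Ordinal ha))%N.
  apply: (@leq_trans (lam a)) => //; rewrite -pg.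
  apply: (down (p a - a)%N); rewrite /=; lia.
case/(placed_codom pl) => b /(congr1 val) /= hb.
have ba : (b < a)%N.
  by rewrite ltnNge leq_eqVlt; apply/negP => /orP[/eqP/val_inj e|/hp]; [subst b|]; lia.
have := IH b; move: hb ba ac; rewrite /=; lia.
Qed.

Lemma placed_mpolyX p g : placed p g -> 'X_[g] = \prod_a 'X_(p a) ^+ lam a :> A.
Proof.
move=> pl; case: (pl) => _ pg p0; rewrite mpolyXE_id.
rewrite (bigID [pred i | i \in codom p]) /= [X in _ * X]big1 ?mulr1; last first.
  by move=> i hi; rewrite p0 // => a; apply: contraNneq hi => <-; apply: codom_f.
rewrite -big_uniq /=; last by rewrite map_inj_uniq ?enum_uniq //; apply: placed_inj pl.
rewrite big_image /=; apply: eq_bigr => a _; by rewrite pg.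
Qed.

(** As [lam] is weakly decreasing, an ascent is always a zero followed by a part. Whichever ascent
    is picked, the swap moves that part one step left and lowers the sum of the positions by 1, so
    this sum bounds the fuel needed. *)
Lemma demazure_recE fuel g p : placed p g -> (\sum_a p a <= fuel)%N ->
  demazure_rec R fuel g = \det (flag_mx p).
Proof.
elim: fuel g p => [|fuel IH] g p pl hs.
all: have unf f : demazure_rec R f g = match ascent g with None => 'X_[g]
  | Some ij => if f is f'.+1 then pi_op ij.1 ij.2 (demazure_rec R f' (mswap ij.1 ij.2 g))
     else 0 end by case: f.
all: rewrite unf {unf} /ascent; case: pickP => [[i j] /= /andP[/eqP hj lt]|hN].
2,4: rewrite flag_det_base ?(placed_mpolyX pl) //; apply: (placed_sorted pl) => i j hj.
2,3: by have := hN (i, j); rewrite /= hj eqxx /= ltnNge => /negbFE.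
all: case: (pl) => hp pg p0.
all: have [a ea] := placed_codom pl (leq_ltn_trans (leq0n _) lt).
  move: hs; rewrite (bigD1 a) //= ea hj; lia.
have ni b : p b != i.
  apply/eqP => eb; have ba : (b < a)%N.
    rewrite ltnNge; apply/negP; rewrite leq_eqVlt => /orP[/eqP/val_inj e|/hp].
      by move: hj; rewrite -ea e eb; lia.
    by rewrite ea eb hj; lia.
  by move: lt; rewrite -ea -eb !pg ltnNge lam_dec // ltnW.
have nj b : b != a -> p b != j.
  by apply: contraNneq; rewrite -ea => /(placed_inj pl) ->.
pose p' b := tperm i j (p b).
have p'a : p' a = i by rewrite /p' ea tpermR.
have p'b b : b != a -> p' b = p b by move=> ne; rewrite /p' tpermD // eq_sym ?ni ?nj.
have pl' : placed p' (mswap i j g).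
  split=> [b c bc|b|q hq].
  - case: (eqVneq b a) => [eb|nb]; case: (eqVneq c a) => [ec|nc].
    + by move: bc; rewrite eb ec ltnn.
    + rewrite eb p'a p'b //; apply: ltn_trans (hp _ _ bc); rewrite eb ea hj; lia.
    + rewrite ec p'a p'b //; have := hp _ _ bc; rewrite ec ea hj ltnS leq_eqVlt.
      by case/orP => // /eqP/val_inj e; move: (ni b); rewrite e eqxx.
    + by rewrite !p'b // hp.
  - by rewrite mnmE /p' tpermK pg.
  - rewrite mnmE p0 // => b; apply: contraNneq (hq b) => e.
    by rewrite /p' e tpermK.
rewrite (IH _ p') //; last first.
  move: hs; rewrite (bigD1 a) //= [X in _ -> (X <= _)%N](bigD1 a) //= p'a ea hj.
  rewrite [X in _ -> (_ + X <= _)%N](eq_bigr (fun b => nat_of_ord (p b))); first by lia.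
  by move=> b nb; rewrite p'b.
by apply: (@flag_det_step i j p p' a) => // b nb; rewrite p'b ?ni ?nj.
Qed.

End DemazureDet.

(** * Closure properties of generated ideals *)

Section Ideal.
Context (R : fieldType) (n : nat) (P : {mpoly R[n]} -> Prop).
Local Notation I := (in_ideal P).

Lemma in_ideal0 : I 0.
Proof. by exists [::]; split=> //; rewrite big_nil. Qed.

Lemma in_ideal_gen g : P g -> I g.
Proof.
move=> hg; exists [:: (1, g)]; split; last by rewrite big_seq1 mul1r.
by move=> y; rewrite inE => /eqP ->.
Qed.

Lemma in_idealD f g : I f -> I g -> I (f + g).
Proof.
move=> [s [hs ->]] [t [ht ->]]; exists (s ++ t); split; last by rewrite big_cat.
by move=> y; rewrite mem_cat => /orP[]; [apply: hs|apply: ht].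
Qed.

Lemma in_idealMl f g : I g -> I (f * g).
Proof.
move=> [s [hs ->]]; exists [seq (f * y.1, y.2) | y <- s]; split.
  by move=> _ /mapP[y /hs hy ->].
by rewrite big_map mulr_sumr; apply: eq_bigr => y _; rewrite mulrA.
Qed.

Lemma in_idealZ c g : I g -> I (c *: g).
Proof. by rewrite -mul_mpolyC; apply: in_idealMl. Qed.

Lemma in_idealN g : I g -> I (- g).
Proof. by rewrite -scaleN1r; apply: in_idealZ. Qed.

Lemma in_idealB f g : I f -> I g -> I (f - g).
Proof. by move=> hf hg; apply: in_idealD => //; apply: in_idealN. Qed.

Lemma in_ideal_sum (J : eqType) (r : seq J) (Q : pred J) F :
  (forall j, j \in r -> Q j -> I (F j)) -> I (\sum_(j <- r | Q j) F j).
Proof.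
move=> h; rewrite big_seq_cond.
apply: (big_ind I in_ideal0 in_idealD) => j /andP[]; exact: h.
Qed.

End Ideal.

Lemma in_ideal_sub (R : fieldType) (n : nat) (P Q : {mpoly R[n]} -> Prop) f :
  (forall g, P g -> in_ideal Q g) -> in_ideal P f -> in_ideal Q f.
Proof.
move=> h [s [hs ->]]; apply: in_ideal_sum => y ys _.
by apply: in_idealMl; apply: h; apply: hs.
Qed.

(** * The flagged determinant: leading term and membership in J *)

Section FlagDet.
Context (R : fieldType) (n k m N : nat) (lam : 'I_m -> nat) (p : 'I_m -> 'I_n).
Context (g : 'X_{1..n}).
Hypothesis lam_gt0 : forall a, (0 < lam a)%N.
Hypothesis lamN : forall a b : 'I_m, (lam a + b < N)%N.
Hypothesis pl : placed lam p g.
Local Notation A := {mpoly R[n]}.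
Local Notation x := (@xvar R n).
Local Notation M := (flag_mx R N lam p).

Lemma sum_placed (c : 'I_m -> nat) a : (\sum_b U_(p b) *+ c b)%MM (p a) = c a.
Proof.
rewrite mnm_sumE (bigD1 a) //= big1 ?addn0 => [|b nb].
  by rewrite mulmnE mnm1E eqxx mul1n.
by rewrite mulmnE mnm1E (inj_eq (placed_inj pl)) (negPf nb) mul0n.
Qed.

Lemma sum_placed_out (c : 'I_m -> nat) i : (forall a, p a != i) ->
  (\sum_b U_(p b) *+ c b)%MM i = 0%N.
Proof.
by move=> h; rewrite mnm_sumE big1 // => b _; rewrite mulmnE mnm1E (negPf (h b)).
Qed.

(** The entry is h of index lam a + b - a in the variables up to x_(p a); the coefficient is 0
    exactly when this index would be negative. *)
Lemma lead_flag_entry a b :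
  lead (M a b) (U_(p a) *+ (lam a + b - a))%MM (a <= lam a + b)%:R.
Proof.
rewrite mxE coefXnM ltnNge; case: leqP => /= h; last first.
  by split=> [|m']; rewrite ?mcoeff0 // msupp0.
rewrite -hcompE; first exact: lead_hcomp.
  by apply: leq_ltn_trans (lamN a b); apply: leq_subr.
by [].
Qed.

(* The diagonal term is the strict maximum: the last index moved by a
   permutation moves down. *)
Lemma lead_flag_det : lead (\det M) g 1.
Proof.
case: (pl) => hp pg p0.
pose mon (s : 'S_m) : 'X_{1..n} := (\sum_a U_(p a) *+ (lam a + s a - a))%MM.
have mon1 : mon 1%g = g.
  apply/mnmP => i; case: (pickP (fun a => p a == i)) => [a /eqP <-|h].
    by rewrite sum_placed perm1 addnK pg.
  by rewrite sum_placed_out ?p0 // => a; rewrite h.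
have monlt (s : 'S_m) : s != 1%g -> neglex_lt (mon s) g.
  move=> ns; have /existsP[a0 ha0] : [exists a, s a != a].
    apply: contraNT ns => /existsPn h; apply/eqP/permP => a; rewrite perm1.
    by apply/eqP; have := h a; rewrite negbK.
  case: (@arg_maxnP _ a0 (fun a => s a != a) val ha0) => a ha hmax.
  have fixb (b : 'I_m) : (a < b)%N -> s b = b.
    by move=> ab; apply/eqP; apply: contraLR ab => /hmax; rewrite -leqNgt.
  have sa : (s a < a)%N.
    rewrite ltn_neqAle ha /= leqNgt; apply/negP => /fixb/perm_inj e.
    by rewrite e eqxx in ha.
  (* The exponent drops at x_(p a) and agrees at every larger variable, which is what neglex
     compares. *)
  apply/neglex_ltP; exists (p a) => [|i hi].
    by rewrite sum_placed pg; have := lam_gt0 a; lia.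
  case: (pickP (fun b => p b == i)) => [b /eqP eb|h]; last first.
    by rewrite sum_placed_out ?p0 // => b; rewrite h.
  rewrite -eb sum_placed pg fixb ?addnK // ltnNge leq_eqVlt; apply/negP.
  case/orP => [/eqP/val_inj e|/hp]; first by rewrite -eb e ltnn in hi.
  by rewrite eb => hi'; move: (ltn_trans hi hi'); rewrite ltnn.
rewrite /determinant (bigD1 1%g) //= odd_perm1 expr0 mul1r.
apply: leadD0.
  have := lead_prod (index_enum _) (fun a => lead_flag_entry a ((1 : 'S_m)%g a)).
  rewrite [X in lead _ X]mon1 [X in lead _ _ X]big1 // => a _.
  by rewrite perm1 leq_addl.
move=> m' /msupp_sum_le/flattenP[t /mapP[s hs ->] hm'].
move: hs; rewrite mem_filter => /andP[ns _]; apply: neglex_le_lt_trans (monlt _ ns).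
have [_ +] := lead_prod (index_enum _) (fun a => lead_flag_entry a (s a)); apply.
by case: (odd_perm s) hm'; rewrite ?expr1 ?expr0 ?mulN1r ?mul1r // (perm_mem (msuppN _)).
Qed.

Hypothesis mk : (m + k = n.+1)%N.
Hypothesis k_gt0 : (0 < k)%N.
Hypothesis k_len : (k <= n)%N.
Hypothesis lamE : forall a, (lam a + p a = k + a)%N.
Local Notation J := (in_ideal_seq (J_gens R n k)).

Lemma eser_in_ideal l : (m <= l)%N -> J (eser x n)`_l.
Proof.
move=> ml; case: (leqP l n) => ln; last first.
  by rewrite nth_default; [apply: in_ideal0|apply: leq_trans (size_eser _ _) _].
rewrite eserE; apply: in_idealMl; apply: in_ideal_gen.
by rewrite mem_cat; apply/orP; right; apply: map_f; rewrite mem_iota; lia.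
Qed.

Lemma flag_det_in_ideal : J (\det M).
Proof.
have m_gt0 : (0 < m)%N by lia.
pose v : 'cV[A]_m := \col_b (eser x n)`_(m.-1 - b).
have Mv a : J ((M *m v) a ord0).
  pose F l := (eser x n)`_l * ('X^a * hser N x (p a).+1)`_(lam a + m.-1 - l).
  (* By [lamE] the index lam a + m - 1 equals n + a - p a, one more than the degree bound of the
     polynomial left after cancellation. *)
  have full : \sum_(0 <= l < (lam a + m.-1).+1) F l = 0.
    rewrite big_mkord -coefM mulrCA.
    have hN : (lam a + m.-1 < N)%N.
      have hm : (m.-1 < m)%N by lia.
      exact: (lamN a (Ordinal hm)).
    rewrite (eqmMl _ (eser_hser_ge x (ltn_ord (p a)))) // nth_default //.
    apply: leq_trans (size_polyMleq _ _) _; rewrite size_polyXn.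
    have := size_prod_lin (index_iota (p a).+1 n) x; rewrite size_iota.
    have := lamE a; have := ltn_ord (p a); move: (size _); lia.
  have -> : (M *m v) a ord0 = \sum_(0 <= l < m) F l.
    rewrite big_nat_rev big_mkord mxE; apply: eq_bigr => b _; rewrite !mxE /F mulrC.
    by congr (_`__ * _`__); have := ltn_ord b; lia.
  (* The terms with l at least m = n - k + 1 carry e_l, a generator of J or zero; so the
     complementary sum, which is the row of M v, lies in J too. *)
  move: full; rewrite (@big_cat_nat _ _ _ m) //=; last by lia.
  move/eqP; rewrite addr_eq0 => /eqP ->; apply: in_idealN; apply: in_ideal_sum => l.
  rewrite mem_index_iota => /andP[ml _] _; rewrite /F mulrC.
  by apply: in_idealMl; apply: eser_in_ideal.
have hm : (m.-1 < m)%N by lia.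
(* The adjugate identity is read at the last row, where the entry of [v] is the constant coefficient
   1. *)
have e : \det M = (\adj M *m (M *m v)) (Ordinal hm) ord0.
  rewrite mulmxA mul_adj_mx mul_scalar_mx !mxE subnn eser_coef0.
  by rewrite mulr1.
by rewrite e mxE; apply: in_ideal_sum => a _ _; apply: in_idealMl; apply: Mv.
Qed.

End FlagDet.

(** * Parts and positions of gamma(S)^* *)

Section Gamma.
Context (R : fieldType) (n k : nat) (S : {set 'I_n}).

Lemma enum_val_ltn (a b : 'I_#|S|) : (a < b)%N -> (enum_val a < enum_val b)%N.
Proof.
move=> ab; have x0 := enum_val a.
have srt : sorted (relpre val ltn) (enum S).
  apply: sorted_filter; first by move=> i j l; apply: ltn_trans.
  by rewrite -sorted_map -enumT val_enum_ord iota_ltn_sorted.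
rewrite !(enum_val_nth x0).
have tr : transitive (relpre (@nat_of_ord n) ltn) by move=> i j l; apply: ltn_trans.
by apply: (sorted_ltn_nth tr x0 srt); rewrite ?inE -?cardE.
Qed.

Lemma leq_enum_val (a : 'I_#|S|) : (a <= enum_val a)%N.
Proof.
case: a => a; elim: a => // a IH ha.
have lt := @enum_val_ltn (Ordinal (ltnW ha)) (Ordinal ha) (ltnSn a).
exact: leq_ltn_trans (IH (ltnW ha)) lt.
Qed.

(** The count subtracted in [gammaS] is the rank of the element in [S]. *)
Lemma card_below (a : 'I_#|S|) : #|[set t in S | (t < enum_val a)%N]| = a.
Proof.
have -> : [set t in S | (t < enum_val a)%N] =
    [set enum_val b | b : 'I_#|S| & (b < a)%N].
  apply/setP => t; rewrite inE; apply/andP/imsetP => [[tS lt]|[b]].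
    exists (enum_rank_in tS t); last by rewrite enum_rankK_in.
    rewrite inE ltnNge; apply: contraTN lt; rewrite -leqNgt leq_eqVlt.
    case/orP => [/eqP/val_inj -> |/enum_val_ltn/ltnW]; by rewrite enum_rankK_in.
  by rewrite inE => lt ->; rewrite enum_valP enum_val_ltn.
rewrite card_imset; last exact: enum_val_inj.
rewrite -sum1dep_card -(big_mkord (fun b => (b < a)%N) (fun => 1%N)).
rewrite (@big_cat_nat _ _ _ a) //=; last by apply: ltnW.
rewrite [X in (_ + X)%N]big_nat_cond [X in (_ + X)%N]big_pred0 => [|b]; last by lia.
rewrite addn0 big_nat_cond (eq_bigl (fun b => (0 <= b < a)%N && true)) => [|b]; last first.
  by rewrite leq0n /= andbT; case: (b < a)%N.
by rewrite -big_nat_cond sum_nat_const_nat subn0 muln1.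
Qed.

Hypothesis cardS : (#|S| + k = n.+1)%N.

(** Reversing the composition makes the largest element of [S] the leftmost position, hence a
    reversal of both the rank and the index. *)
Definition gpos (a : 'I_#|S|) : 'I_n := rev_ord (enum_val (rev_ord a)).
Definition glam (a : 'I_#|S|) : nat := mrev (gammaS S) (gpos a).

Lemma gpos_ltn (a b : 'I_#|S|) : (a < b)%N -> (gpos a < gpos b)%N.
Proof.
have rev_ltn c (u v : nat) : (u < v)%N -> (v < c)%N -> (c - v.+1 < c - u.+1)%N by lia.
move=> ab; have h : (rev_ord b < rev_ord a)%N := rev_ltn _ _ _ ab (ltn_ord b).
have := enum_val_ltn h; rewrite /gpos /=; have := ltn_ord (enum_val (rev_ord a)).
by move: (enum_val _) (enum_val _) => u v; lia.
Qed.

(** This is lam_a - a = k - p_a, where |S| = n - k + 1 enters. Positivity holds because the element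
    of rank r in [S] is at least r. *)
Lemma glamE a : (glam a + gpos a = k + a)%N /\ (0 < glam a)%N.
Proof.
rewrite /glam !mnmE /gpos rev_ordK enum_valP card_below /=.
have arith c u e : (c + k = n.+1)%N -> (u < c)%N -> (c - u.+1 <= e)%N -> (e < n)%N ->
  (e.+1 - (c - u.+1) + (n - e.+1) = k + u)%N /\ (0 < e.+1 - (c - u.+1))%N by lia.
exact: (arith _ _ _ cardS (ltn_ord a) (leq_enum_val (rev_ord a)) (ltn_ord _)).
Qed.

(** Consecutive positions differ by at least 1, while the sum of part and position grows by exactly
    1 with the index. *)
Lemma glam_dec (a b : 'I_#|S|) : (a <= b)%N -> (glam b <= glam a)%N.
Proof.
move=> ab; have [ha _] := glamE a; have [hb _] := glamE b.
suff : (gpos a + (b - a) <= gpos b)%N by lia.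
have [d hd] : exists d, (b = (a + d)%N :> nat) by exists (b - a)%N; lia.
clear ha hb ab; elim: d b hd => [|d IH] b hd.
  by have -> : b = a; [apply: val_inj; rewrite /= hd addn0|rewrite subnn addn0].
have hc : (a + d < #|S|)%N by apply: leq_ltn_trans (ltn_ord b); rewrite hd leq_add2l.
have lt : (Ordinal hc < b)%N by rewrite /= hd addnS.
have := IH (Ordinal hc) erefl; rewrite hd /= !addKn addnS => h.
exact: leq_ltn_trans h (gpos_ltn lt).
Qed.

Lemma placed_gamma : placed glam gpos (mrev (gammaS S)).
Proof.
split=> // [|i hi]; first exact: gpos_ltn.
rewrite !mnmE; case: ifP => // iS; case/negP: (hi (rev_ord (enum_rank_in iS (rev_ord i)))).
by rewrite /gpos rev_ordK enum_rankK_in // rev_ordK.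
Qed.

Lemma glamN (a b : 'I_#|S|) : (glam a + b < (n + n).+1)%N.
Proof.
have [h _] := glamE a; have := ltn_ord a; have := ltn_ord b; have := ltn_ord (gpos a).
have := max_card (mem S); rewrite card_ord; lia.
Qed.

Lemma demazure_gamma :
  demazure R (mrev (gammaS S)) = \det (flag_mx R (n + n).+1 glam gpos).
Proof.
have gt0 a : (0 < glam a)%N by case: (glamE a).
apply: (demazure_recE R gt0 glam_dec glamN placed_gamma).
(* There are at most n positions, each less than n, so the fuel n * n suffices. *)
apply: (@leq_trans (\sum_(a < #|S|) n)%N); first by apply: leq_sum => a _; apply: ltnW.
rewrite sum_nat_const card_ord leq_mul2r; apply/orP; right.
by have := max_card (mem S); rewrite card_ord.
Qed.

Lemma lead_demazure_gamma : lead (demazure R (mrev (gammaS S))) (mrev (gammaS S)) 1.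
Proof.
rewrite demazure_gamma; apply: lead_flag_det; [|exact: glamN|exact: placed_gamma].
by move=> a; case: (glamE a).
Qed.

Lemma demazure_gamma_in_ideal : (0 < k)%N -> (k <= n)%N ->
  in_ideal_seq (J_gens R n k) (demazure R (mrev (gammaS S))).
Proof.
move=> k0 kn; rewrite demazure_gamma; apply: flag_det_in_ideal => // [|a].
  exact: glamN.
by case: (glamE a).
Qed.

End Gamma.

(** * Standard monomials *)

Section Standard.
Context (k : nat).

(* Exponents are read from the largest variable down; [r] counts the entries
   met so far that did not exceed the counter.  If at least n-k+1
   entries exceed it, the first n-k+1 of their positions form a set S such that
   the monomial is divisible by that of gamma(S)^*. *)
Fixpoint std (r : nat) (e : seq nat) : bool :=
  if e is a :: e' then (a < k)%N && std (if (a <= r)%N then r.+1 else r) e'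
  else (k <= r)%N.

(** [b] marks the entries chosen for S. Before a marked position q the counter equals r + q minus
    the number of earlier marks, so the inequality says that the entry exceeds the counter. *)
Lemma nonstd_mask r e : all (fun a => a < k)%N e -> ~~ std r e ->
  exists b : seq bool, [/\ size b = size e, count id b = (r + size e).+1 - k &
    forall q, nth false b q -> r + q < nth 0 e q + count id (take q b)]%N.
Proof.
elim: e r => [|a e IH] r /=.
  move=> _; rewrite -ltnNge => hr; exists [::]; split=> //=; first by lia.
  by move=> q; rewrite nth_nil.
case/andP=> ak he; rewrite ak /=; case: leqP => ar.
  case/(IH _ he) => b [sb cb hb]; exists (false :: b); split=> /=; [by rewrite sb|lia|].
  by case=> // q /hb /=; lia.
case/(IH _ he) => b [sb cb hb].
(* The required number of marks may already be zero; then nothing is marked. *)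
case: (leqP k (r + size e).+1) => hk.
  exists (true :: b); split=> /=; [by rewrite sb|lia|].
  by case=> [_|q /hb] /=; rewrite ?take0 /=; lia.
exists (nseq (size e).+1 false); split.
- by rewrite size_nseq.
- by rewrite count_nseq /=; lia.
- by move=> q; rewrite nth_nseq; case: ifP.
Qed.

Context (n : nat).

Definition revexp (m : 'X_{1..n}) : seq nat := rev [seq m i | i <- enum 'I_n].
Definition mnm_of (e : seq nat) : 'X_{1..n} := [multinom nth 0 (rev e) i | i < n]%N.

Lemma size_revexp m : size (revexp m) = n.
Proof. by rewrite size_rev size_map size_enum_ord. Qed.

Lemma nth_revexp m (i : 'I_n) : nth 0 (revexp m) i = m (rev_ord i).
Proof.
rewrite nth_rev size_map size_enum_ord // (nth_map i) ?size_enum_ord //=; last first.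
  by have := ltn_ord i; lia.
congr (m _); apply: val_inj; rewrite /= nth_enum_ord //; have := ltn_ord i; lia.
Qed.

Lemma revexpK : cancel revexp mnm_of.
Proof.
move=> m; apply/mnmP => i; rewrite mnmE revK (nth_map i) ?size_enum_ord //.
by rewrite nth_ord_enum.
Qed.

Lemma mnm_ofK e : size e = n -> revexp (mnm_of e) = e.
Proof.
move=> se; rewrite -[RHS]revK; congr rev; apply: (@eq_from_nth _ 0%N).
  by rewrite size_map size_enum_ord size_rev.
rewrite size_map size_enum_ord => i hi; rewrite (nth_map (Ordinal hi)) ?size_enum_ord //.
by rewrite mnmE nth_enum_ord.
Qed.

Lemma card_mask (b : seq bool) q : (q <= n)%N -> size b = n ->
  #|[set i : 'I_n | nth false b i && (i < q)%N]| = count id (take q b).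
Proof.
move=> qn sb; rewrite -sum1dep_card -(big_mkord (fun i => nth false b i && (i < q)%N) (fun => 1%N)).
rewrite -sum1_count (big_nth false) size_take sb.
have -> : (if (q < n)%N then q else n) = q by case: ltnP qn; lia.
rewrite (@big_cat_nat _ _ _ q) //= [X in (_ + X)%N]big_nat_cond.
rewrite [X in (_ + X)%N]big_pred0 => [|i]; last first.
  by rewrite andbC; case: (ltnP i q) => hi; rewrite ?andbF //= [(q <= i)%N]leqNgt hi.
rewrite addn0 big_nat_cond [RHS]big_nat_cond; apply: eq_bigl => i.
by case: (ltnP i q) => hi; rewrite ?andbF //= nth_take // andbT.
Qed.

Lemma nonstd_divides m : (0 < k)%N -> (k <= n)%N -> ~~ std 0 (revexp m) ->
  (exists i, (k <= m i)%N) \/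
  exists2 S, S \in admissible_sets n k & mdivides (mrev (gammaS S)) m.
Proof.
move=> k0 kn ns.
case: (boolP [exists i, (k <= m i)%N]) => [/existsP|/existsPn hlt]; first by left.
right; have hall : all (fun a => a < k)%N (revexp m).
  by apply/allP => a; rewrite mem_rev => /mapP[i _ ->]; rewrite ltnNge.
have [b []] := nonstd_mask hall ns; rewrite size_revexp add0n => sb cb hb.
pose S := [set i : 'I_n | nth false b i].
have below (q : nat) : (q <= n)%N -> #|[set t in S | (t < q)%N]| = count id (take q b).
  move=> qn; rewrite -card_mask //; congr #|pred_of_set _|.
  by apply/setP => t; rewrite !inE.
have cS : #|S| = (n.+1 - k)%N.
  rewrite -cb -[in RHS](take_size b) sb -below //; congr #|pred_of_set _|.
  by apply/setP => t; rewrite !inE ltn_ord andbT.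
have hS (i : 'I_n) : i \in S -> (i.+1 <= m (rev_ord i) + #|[set t in S | (t < i)%N]|)%N.
  by rewrite inE => /hb; rewrite add0n nth_revexp below // ltnW.
exists S.
  rewrite mem_enum inE cS; apply/andP; split; first by apply/eqP; lia.
  (* If S contained the last index, the exponent there would be at least n - (n - k) = k, a case
     already excluded. *)
  apply/forallP => i; apply/implyP => iS; rewrite ltn_neqAle ltn_ord andbT.
  apply/eqP => ei; have := hS i iS; rewrite ei.
  have -> : [set t in S | (t < i)%N] = S :\ i.
    apply/setP => t; rewrite !inE andbC; congr (_ && _).
    have : (t < i.+1)%N by rewrite ei.
    rewrite ltnS leq_eqVlt; case: (eqVneq t i) => [->|ne]; first by rewrite ltnn.
    by case/orP => // /eqP/val_inj e; rewrite e eqxx in ne.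
  have := cardsD1 i S; rewrite iS cS add1n; have := hlt (rev_ord i).
  by move: (m _) #|_| => u w; rewrite -ltnNge; lia.
apply/forallP => i; rewrite !mnmE; case: ifP => // iS.
by have := hS _ iS; rewrite rev_ordK leq_subLR addnC.
Qed.

End Standard.

(** * Independence of standard monomials on the points *)

Section Independence.
Context (F : fieldType) (k : nat) (alpha : nat -> F).
Hypothesis alpha_inj : injective alpha.
Implicit Types (c : seq nat -> F) (ys : seq F).

(* Value at [ys] of the polynomial with coefficients [c], cut to degrees < k. *)
Fixpoint ev c ys : F :=
  if ys is y :: ys' then \sum_(a < k) ev (fun e => c (val a :: e)) ys' * y ^+ a
  else c [::].

Lemma ev_ext c c' ys : (forall e, size e = size ys -> c e = c' e) -> ev c ys = ev c' ys.
Proof.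
elim: ys c c' => [|y ys IH] c c' h /=; first exact: h.
apply: eq_bigr => a _; rewrite (IH _ (fun e => c' (val a :: e))) // => e he.
by apply: h; rewrite /= he.
Qed.

Lemma ev0 c ys : (forall e, size e = size ys -> c e = 0) -> ev c ys = 0.
Proof.
move=> h; rewrite (ev_ext (c' := fun=> 0)) //; elim: ys {h} => //= y ys IH.
by rewrite big1 // => a _; rewrite IH mul0r.
Qed.

Lemma ev_sum (I : Type) (r : seq I) (d : I -> F) (C : I -> seq nat -> F) ys :
  ev (fun e => \sum_(i <- r) d i * C i e) ys = \sum_(i <- r) d i * ev (C i) ys.
Proof.
elim: ys C => //= y ys IH C.
under eq_bigr => a _ do rewrite (IH (fun i e => C i (val a :: e))) mulr_suml.
rewrite exchange_big; apply: eq_bigr => i _; rewrite mulr_sumr.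
by apply: eq_bigr => a _; rewrite mulrA.
Qed.

Lemma ev_delta e0 ys : size e0 = size ys -> all (fun a => a < k)%N e0 ->
  ev (fun e => (e == e0)%:R) ys = \prod_(z <- zip ys e0) z.1 ^+ z.2.
Proof.
elim: ys e0 => [|y ys IH] [|a e0] //=; first by rewrite big_nil.
case=> se /andP[ak he]; rewrite big_cons /= -IH // (bigD1 (Ordinal ak)) //=.
rewrite big1 ?addr0 => [|b nb]; last first.
  rewrite ev0 ?mul0r // => e _; rewrite eqseq_cons.
  case: eqP => // eb; case/eqP: nb; exact: val_inj.
rewrite mulrC; congr (_ * _); apply: ev_ext => e _.
by rewrite eqseq_cons eqxx.
Qed.

(* Points are listed from the last coordinate down, like the exponents. *)
Fixpoint valid ys : bool :=
  if ys is y :: ys' then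
    [&& y \in mkseq alpha (k + size ys'), y \notin ys' & valid ys']
  else true.

Definition miss ys := count (fun j => alpha j \notin ys) (iota 0 k).

Lemma valid_drop q ys : valid ys -> valid (drop q ys).
Proof. by elim: q ys => [|q IH] [|y ys] //= /and3P[_ _ /IH]. Qed.

Lemma valid_uniq ys : valid ys -> uniq ys.
Proof. by elim: ys => //= y ys IH /and3P[_ -> /IH]. Qed.

Lemma valid_sub ys : valid ys -> {subset ys <= mkseq alpha (k + (size ys).-1)}.
Proof.
elim: ys => //= y ys IH /and3P[hy _ /IH h] z; rewrite inE => /orP[/eqP -> //|/h].
case/mapP => j; rewrite mem_iota => hj ->; apply: map_f; rewrite mem_iota.
by move: hj; case: (ys) => [|w ws] /=; lia.
Qed.

Lemma uniq_mkseq_alpha q : uniq (mkseq alpha q).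
Proof. by rewrite map_inj_uniq ?iota_uniq. Qed.

Lemma poly_eq0_roots (P : {poly F}) (rs : seq F) : uniq rs -> all (root P) rs ->
  (size P <= size rs)%N -> P = 0.
Proof.
move=> u ar sz; apply/eqP; apply: contraTT sz => nz.
by rewrite -ltnNge; apply: max_poly_roots.
Qed.

Lemma miss_cons y ys : (miss (y :: ys) <= miss ys)%N.
Proof. by apply: sub_count => j /=; rewrite inE negb_or => /andP[]. Qed.

Lemma miss_cons_lt j ys : (j < k)%N -> alpha j \notin ys ->
  (miss (alpha j :: ys) < miss ys)%N.
Proof.
move=> jk hj; rewrite /miss.
have := count_predUI (fun i => alpha i \notin alpha j :: ys) (pred1 j) (iota 0 k).
rewrite count_uniq_mem ?iota_uniq // mem_iota jk /= addn1.
rewrite [X in (_ + X)%N = _](@eq_count _ _ pred0) => [|i] /=; last first.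
  by apply/idP => /andP[hi /eqP ei]; rewrite ei inE eqxx in hi.
rewrite count_pred0 addn0 => <-.
by apply: sub_count => i /= /orP[|/eqP -> //]; rewrite inE negb_or => /andP[].
Qed.

(* Counting roots in the first variable: a point [ys] missing at most [r] of the
   first k alphas extends in k ways, one missing [r.+1] of them in [r.+1] ways. *)
Lemma std_independent n r c :
  (forall e, size e = n -> ~~ std k r e -> c e = 0) ->
  (forall ys, size ys = n -> valid ys -> (miss ys <= r)%N -> ev c ys = 0) ->
  forall e, size e = n -> c e = 0.
Proof.
elim: n r c => [|n IH] r c hc hY e.
  move/size0nil => ->; case: (leqP k r) => kr; last by apply: hc => //=; rewrite -ltnNge.
  apply: (hY [::]) => //; apply: leq_trans kr; rewrite /miss.
  by apply: leq_trans (count_size _ _) _; rewrite size_iota.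
pose P ys := \poly_(a < k) ev (fun e => c (a :: e)) ys.
have PE y ys : ev c (y :: ys) = (P ys).[y] by rewrite /P horner_poly.
have P0 ys : P ys = 0 -> forall a, (a < k)%N -> ev (fun e => c (a :: e)) ys = 0.
  move=> e0 a ak; have := coef_poly k (fun a => ev (fun e => c (a :: e)) ys) a.
  by rewrite -/(P ys) e0 coef0 ak.
have big_a a e' : (k <= a)%N -> size e' = n -> c (a :: e') = 0.
  by move=> ka se; apply: hc; rewrite /= ?se // ltnNge ka.
have step1 ys : size ys = n -> valid ys -> (miss ys <= r)%N -> P ys = 0.
  move=> sy vy my; pose rs := [seq y <- mkseq alpha (k + n) | y \notin ys].
  apply: (@poly_eq0_roots _ rs).
  - by rewrite filter_uniq ?uniq_mkseq_alpha.
  - apply/allP => y; rewrite mem_filter => /andP[ny hy]; rewrite /root -PE hY //=.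
    + by rewrite sy.
    + by rewrite sy hy ny.
    + exact: leq_trans (miss_cons _ _) my.
  - apply: leq_trans (size_poly _ _) _; rewrite size_filter.
    have := count_predC (mem ys) (mkseq alpha (k + n)); rewrite size_mkseq.
    have : (count (mem ys) (mkseq alpha (k + n)) <= n)%N.
      rewrite -size_filter -sy; apply: uniq_leq_size.
        by rewrite filter_uniq ?uniq_mkseq_alpha.
      by move=> y; rewrite mem_filter => /andP[].
    rewrite -[X in (k <= X)%N]/(count (predC (mem ys)) (mkseq alpha (k + n))).
    by move: (count _ _) (count _ _) => u w; lia.
(* An entry a > r leaves the counter at r, so induction applies at r to the coefficients of y^a. *)
have high a e' : (r < a)%N -> size e' = n -> c (a :: e') = 0.
  move=> ra se; case: (leqP k a) => ak; first exact: big_a.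
  apply: (IH r (fun e => c (a :: e))) => // [e1 s1 ns|ys sy vy my].
    by apply: hc; rewrite /= ?s1 // ak leqNgt ra.
  by apply: P0 => //; apply: step1.
(* By [high] the degree in y is at most r, so the r + 1 missing alphas are enough roots. This feeds
   the induction at r + 1 for the entries a <= r. *)
have step2 ys : size ys = n -> valid ys -> (miss ys <= r.+1)%N -> P ys = 0.
  move=> sy vy; rewrite leq_eqVlt => /orP[/eqP my|]; last exact: step1.
  pose rs := [seq alpha j | j <- iota 0 k & alpha j \notin ys].
  apply: (@poly_eq0_roots _ rs).
  - by rewrite map_inj_uniq // filter_uniq ?iota_uniq.
  - apply/allP => y /mapP[j]; rewrite mem_filter mem_iota => /andP[nj jk] ->.
    rewrite /root -PE hY //=.
    + by rewrite sy.
    + by rewrite vy nj sy map_f // mem_iota; lia.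
    + by rewrite -ltnS -my miss_cons_lt.
  - rewrite size_map size_filter [count _ _]my; apply/leq_sizeP => a ra.
    by rewrite coef_poly; case: ifP => // _; apply: ev0 => e'; rewrite sy; apply: high.
case: e => // a e [se]; case: (leqP k a) => ak; first exact: big_a.
case: (ltnP r a) => ra; first exact: high.
apply: (IH r.+1 (fun e => c (a :: e))) => // [e1 s1 ns|ys sy vy my].
  by apply: hc; rewrite /= ?s1 // ak ra.
by apply: P0 => //; apply: step2.
Qed.

Context (n : nat).

Lemma meval_ev (p : {mpoly F[n]}) (v : 'I_n -> F) :
  (forall m, m \in msupp p -> forall i, (m i < k)%N) ->
  p.@[v] = ev (fun e => p@_(mnm_of n e)) (rev [seq v i | i <- enum 'I_n]).
Proof.
move=> hp; set ys := rev _.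
have sy : size ys = n by rewrite size_rev size_map size_enum_ord.
pose C (m : 'X_{1..n}) (e : seq nat) : F := (e == revexp m)%:R.
rewrite (@ev_ext _ (fun e => \sum_(m <- msupp p) p@_m * C m e)) => [|e]; last first.
  rewrite sy => se; rewrite {1}[p]mpolyE raddf_sum /=; apply: eq_bigr => m _.
  rewrite mcoeffZ mcoeffX /C; congr (_ * (nat_of_bool _)%:R).
  by apply/eqP/eqP => [->|->]; rewrite ?mnm_ofK ?revexpK.
rewrite ev_sum mevalE big_seq [RHS]big_seq; apply: eq_bigr => m hm; congr (_ * _).
rewrite ev_delta ?size_revexp ?sy //; last first.
  by apply/allP => a; rewrite mem_rev => /mapP[i _ ->]; apply: hp.
rewrite /revexp /ys -rev_zip ?size_map // (perm_big _ (permEl (perm_rev _))) /=.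
by rewrite zip_map big_map big_enum.
Qed.

End Independence.

(** * Deforming the ideal to a point configuration *)

Section Homogeneous.
Context (R : fieldType) (n : nat).
Implicit Types (p q f : {mpoly R[n]}) (m u : 'X_{1..n}).

Lemma mcoeff_pihomog d p m :
  (pihomog mdeg d p)@_m = if mdeg m == d then p@_m else 0.
Proof.
rewrite pihomogE raddf_sum /=; case: (eqVneq (mdeg m) d) => hm; last first.
  rewrite big1 // => u /eqP hu; rewrite mcoeffZ mcoeffX.
  by case: eqP => [e|]; rewrite ?mulr0 // -hu e eqxx in hm *.
rewrite [in RHS](mpolyE p) raddf_sum /= [RHS](bigID (fun u => mdeg u == d)) /=.
rewrite [X in _ = _ + X]big1 ?addr0 // => u hu; rewrite mcoeffZ mcoeffX.
by case: eqP => [e|]; rewrite ?mulr0 // e hm eqxx in hu *.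
Qed.

Lemma pihomogM d e p q : q \is e.-homog for mdeg ->
  pihomog mdeg d (p * q) = (if (e <= d)%N then pihomog mdeg (d - e) p else 0) * q.
Proof.
move=> hq; rewrite [p]mpolyE mulr_suml raddf_sum /=.
have -> : (if (e <= d)%N then pihomog mdeg (d - e) (\sum_(m <- msupp p) p@_m *: 'X_[m])
    else 0) = \sum_(m <- msupp p) (if (mdeg m + e == d)%N then p@_m *: 'X_[m] else 0).
  case: leqP => hd.
    rewrite raddf_sum /=; apply: eq_bigr => m _; rewrite linearZ /= pihomogX.
    have -> : (mdeg m + e == d)%N = (mdeg m == d - e)%N by lia.
    by case: ifP => //; rewrite scaler0.
  rewrite big1 // => m _; case: eqP => //; lia.
rewrite mulr_suml; apply: eq_bigr => m _; rewrite -scalerAl linearZ /=.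
have hX : 'X_[m] * q \is (mdeg m + e).-homog for mdeg.
  by apply: dhomogM => //; rewrite dhomogX.
case: eqP => [<-|/eqP ne]; first by rewrite pihomog_dE // scalerAl.
by rewrite (pihomog_ne0 ne hX) scaler0 mul0r.
Qed.

(* Stated on coefficients, so that it is visibly stable under linear combinations. *)
Definition lowdeg d p := forall m, (d <= mdeg m)%N -> p@_m = 0.

Lemma lowdegD d p q : lowdeg d p -> lowdeg d q -> lowdeg d (p + q).
Proof. by move=> hp hq m hm; rewrite mcoeffD hp ?hq ?addr0. Qed.

Lemma lowdegM d e p q : p \is d.-homog for mdeg -> lowdeg e q -> lowdeg (d + e) (p * q).
Proof.
move=> /dhomogP hp hq m hm; apply: memN_msupp_eq0; apply/negP.
case/msuppM_le/allpairsP => -[u w] /= [hu hw em].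
move: hw; rewrite mcoeff_msupp hq ?eqxx //; have := hp _ hu.
by move: hm; rewrite em mdegD /=; lia.
Qed.

Lemma dhomog_hcomp d j : hcomp R n d j \is d.-homog for mdeg.
Proof.
apply/dhomogP => m; rewrite mcoeff_msupp mcoeff_hcomp.
by case: (mdeg m =P d) => // _; rewrite andFb eqxx.
Qed.

Lemma dhomog_esym d : Defs.esym R n d \is d.-homog for mdeg.
Proof. exact: dhomog_mesym. Qed.

Lemma dhomog_lowdeg d e p : p \is d.-homog for mdeg -> (d < e)%N -> lowdeg e p.
Proof.
move=> hp de m hm; apply: (dhomog_nemf_coeff hp); apply/eqP => /=; lia.
Qed.

Lemma lowdegCM d c p : lowdeg d p -> lowdeg d (c%:MP * p).
Proof. by move=> h m hm; rewrite mcoeffCM h ?mulr0. Qed.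

Lemma lowdeg_sign d r p : lowdeg d p -> lowdeg d ((-1) ^+ r * p).
Proof.
move=> h m hm; rewrite -signr_odd mulr_sign; case: ifP => _; last exact: h.
by rewrite mcoeffN h ?oppr0.
Qed.

End Homogeneous.

(** The factors of [s1] cancel and leave a polynomial of degree at most |s2| - |s1| < d. Evaluated
    at a point of Y, this makes the deformed generators vanish. *)
Lemma coef_lin_geom_sub (F : fieldType) N (s1 s2 : seq F) d :
  uniq s1 -> uniq s2 -> {subset s1 <= s2} -> (d < N)%N -> (size s2 < size s1 + d)%N ->
  (\prod_(y <- s2) lin y * \prod_(y <- s1) geom N y)`_d = 0.
Proof.
move=> u1 u2 sub dN hs; pose rest := [seq y <- s2 | y \notin s1].
have pe : perm_eq s2 (s1 ++ rest).
  apply: uniq_perm => //; last first.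
    move=> y; rewrite mem_cat mem_filter; case: (boolP (y \in s1)) => //= /sub ->.
    by [].
  rewrite cat_uniq u1 filter_uniq // andbT; apply/hasPn => y.
  by rewrite mem_filter => /andP[].
have sr : (size rest < d)%N by rewrite -(ltn_add2l (size s1)) -size_cat -(perm_size pe).
rewrite (perm_big _ pe) /= big_cat /= mulrAC.
rewrite (eqmM (@prod_lin_geom F N F s1 id) (fun _ _ => erefl)) // mul1r nth_default //.
by apply: leq_trans (size_prod_lin _ _) _.
Qed.

(** * Polynomials vanishing on the point set Y *)

Section Points.
Context (F : fieldType) (n k : nat) (alpha : nat -> F).
Hypothesis alpha_inj : injective alpha.
Hypotheses (k_gt0 : (0 < k)%N) (k_len : (k <= n)%N).
Local Notation A := {mpoly F[n]}.
Local Notation x := (@xvar F n).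
Local Notation J := (in_ideal_seq (J_gens F n k)).
Local Notation N := (n + k).+1.
Implicit Types (v : 'I_n -> F) (p q f g s : A) (m u : 'X_{1..n}).

Definition onY v : bool :=
  let ys := rev [seq v i | i <- enum 'I_n] in
  valid k alpha ys && (miss k alpha ys == 0)%N.

Local Notation alphac := (fun i => (alpha i)%:MP_[n]).
Local Notation w v := (meval v \o x).

Lemma mkseq_point v j : (j <= n)%N ->
  mkseq (w v) j = take j [seq v i | i <- enum 'I_n].
Proof.
move=> jn; apply: (@eq_from_nth _ 0) => [|i]; rewrite size_mkseq.
  by rewrite size_take size_map size_enum_ord; case: ltnP jn; lia.
move=> ij; have hi : (i < n)%N by apply: leq_trans jn.
rewrite nth_mkseq // nth_take // (nth_map (Ordinal hi)) ?size_enum_ord //=.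
have -> : x i = 'X_(Ordinal hi) by rewrite -xvarE.
by rewrite mevalXU; congr (v _); apply: val_inj; rewrite /= nth_enum_ord.
Qed.

Lemma point_prefix v j : onY v -> (0 < j <= n)%N ->
  uniq (mkseq (w v) j) /\ {subset mkseq (w v) j <= mkseq alpha (k + j.-1)}.
Proof.
move=> /andP[val _] /andP[j0 jn]; rewrite mkseq_point //.
have := valid_drop (n - j) val.
rewrite drop_rev size_map size_enum_ord subKn // => val'.
have sz : size (take j [seq v i | i <- enum 'I_n]) = j.
  by rewrite size_take size_map size_enum_ord; case: ltnP jn; lia.
split; first by rewrite -rev_uniq; apply: valid_uniq val'.
by move=> y; rewrite -mem_rev => /(valid_sub val'); rewrite size_rev sz.
Qed.

Lemma point_full v : onY v -> {subset mkseq alpha k <= mkseq (w v) n}.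
Proof.
case/andP=> _ /eqP h y /mapP[j]; rewrite mem_iota => hj ->.
rewrite mkseq_point // take_oversize; last by rewrite size_map size_enum_ord.
rewrite -mem_rev.
move/eqP: h; rewrite -leqn0 leqNgt -has_count => /hasPn/(_ j).
by rewrite mem_iota negbK; apply.
Qed.

Lemma meval_eser_hser v (y z : nat -> A) a b d :
  ((eser y a * hser N z b)`_d).@[v] =
  (\prod_(t <- mkseq (meval v \o y) a) lin t *
   \prod_(t <- mkseq (meval v \o z) b) geom N t)`_d.
Proof.
rewrite -coef_map rmorphM /= map_eser map_hser /eser /hser !big_map /index_iota.
by rewrite !subn0.
Qed.

Lemma mkseq_alphac v j : mkseq (meval v \o alphac) j = mkseq alpha j.
Proof. by apply: eq_map => i /=; rewrite mevalC. Qed.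

(** The witness is the coefficient of t^k in the product of k + j - 1 factors 1 - alpha_i t over
    that of the j factors 1 - x_i t. On Y all denominators cancel and degree k - 1 remains; the
    top-degree part is h_k. *)
Lemma lift_hcomp j : (0 < j <= n)%N -> exists g,
  (forall v, onY v -> g.@[v] = 0) /\ lowdeg k (hcomp F n k j - g).
Proof.
move=> hj; exists (eser alphac (k + j.-1) * hser N x j)`_k; split=> [v yv|].
  have [u1 sub] := point_prefix yv hj.
  rewrite meval_eser_hser mkseq_alphac; apply: coef_lin_geom_sub => //.
  - exact: uniq_mkseq_alpha.
  - lia.
  - by rewrite !size_mkseq; case/andP: hj; lia.
rewrite coefM big_ord_recl /= eser_coef0 mul1r subn0 -hcompE //; [|lia|by case/andP: hj].
rewrite opprD addrA subrr sub0r -sumrN => m hm; rewrite raddf_sum big1 // => l _ /=.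
rewrite mcoeffN; apply/eqP; rewrite oppr_eq0; apply/eqP; move: m hm.
rewrite -(map_eser (@mpolyC n F)) coef_map; apply: lowdegCM.
rewrite -hcompE; [|lia|by case/andP: hj].
by apply: dhomog_lowdeg (dhomog_hcomp _ _ _ _) _; rewrite /bump /=; lia.
Qed.

(** Here the factors 1 - x_i t are divided by the first k factors 1 - alpha_i t. Points of Y use all
    these alphas, so degree n - k < r remains. *)
Lemma lift_esym r : (n - k < r <= n)%N -> exists g,
  (forall v, onY v -> g.@[v] = 0) /\ lowdeg r (Defs.esym F n r - g).
Proof.
move=> hr; exists ((-1) ^+ r * (eser x n * hser N alphac k)`_r); split=> [v yv|].
  have hn : (0 < n <= n)%N by lia.
  have [u1 _] := point_prefix yv hn.
  rewrite mevalM meval_eser_hser mkseq_alphac coef_lin_geom_sub ?mulr0 //.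
  - exact: uniq_mkseq_alpha.
  - exact: point_full.
  - lia.
  - by rewrite !size_mkseq; lia.
rewrite coefM big_ord_recr /= subnn prod_geom_coef0 // mulr1 mulrDr.
rewrite eserE mulrA -expr2 sqrr_sign mul1r opprD addrCA subrr addr0.
rewrite mulr_sumr -sumrN => m hm; rewrite raddf_sum big1 // => l _ /=.
rewrite eserE -(map_hser N (@mpolyC n F)) coef_map /= -!mulrA mcoeffN.
rewrite [Defs.esym _ _ _ * _]mulrC; apply/eqP; rewrite oppr_eq0; apply/eqP; move: m hm.
apply: lowdeg_sign; apply: lowdeg_sign; apply: lowdegCM.
exact: dhomog_lowdeg (dhomog_esym _ _ _) _.
Qed.

Lemma J_gens_lift g : g \in J_gens F n k -> exists d g',
  [/\ g \is d.-homog for mdeg, forall v, onY v -> g'.@[v] = 0 & lowdeg d (g - g')].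
Proof.
rewrite mem_cat => /orP[] /mapP[j]; rewrite mem_iota => hj ->.
  have [|g' [h1 h2]] := @lift_hcomp j; first by lia.
  by exists k, g'; split=> //; apply: dhomog_hcomp.
have [|g' [h1 h2]] := @lift_esym j; first by lia.
by exists j, g'; split=> //; apply: dhomog_esym.
Qed.

Lemma J_pihomog d f : J f -> J (pihomog mdeg d f).
Proof.
case=> s [hs ->]; rewrite raddf_sum /=; apply: in_ideal_sum => y ys _.
have [e [g' [hom _ _]]] := J_gens_lift (hs _ ys).
by rewrite (pihomogM _ _ hom); apply: in_idealMl; apply: in_ideal_gen; apply: hs.
Qed.

(** Each generator is replaced by its deformation, and its multiplier by the homogeneous component
    that contributes to degree d; the error stays below degree d. *)
Lemma J_lift d f : J f -> exists g,
  (forall v, onY v -> g.@[v] = 0) /\ lowdeg d (pihomog mdeg d f - g).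
Proof.
case=> s [hs ->]; elim: s hs => [|y s IH] hs.
  exists 0; split=> [v _|]; first by rewrite meval0.
  by rewrite big_nil raddf0 subr0 => m _; rewrite mcoeff0.
have [|g [h1 h2]] := IH; first by move=> z hz; apply: hs; rewrite inE hz orbT.
have [e [g' [hom h3 h4]]] := J_gens_lift (hs y (mem_head _ _)).
pose a := if (e <= d)%N then pihomog mdeg (d - e) y.1 else 0.
exists (a * g' + g); split=> [v yv|].
  by rewrite mevalD mevalM h1 // h3 // mulr0 addr0.
rewrite big_cons raddfD /= (pihomogM _ _ hom) -/a opprD addrACA -mulrBr.
apply: lowdegD => //; rewrite /a; case: leqP => ed; last first.
  by rewrite mul0r => m _; rewrite mcoeff0.
by rewrite -(subnK ed) addnK; apply: lowdegM => //; apply: pihomogP.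
Qed.

(** * Reduction to standard monomials *)

Local Notation stdm := (fun m => std k 0 (revexp m)).
Definition stdsupp p := forall m, ~~ stdm m -> p@_m = 0.

Lemma stdsuppD p q : stdsupp p -> stdsupp q -> stdsupp (p + q).
Proof. by move=> hp hq m hm; rewrite mcoeffD hp ?hq ?addr0. Qed.

(** The case r = 0 of [std_independent]: missing no alpha is the condition in [onY]. *)
Lemma stdsupp_vanish p : stdsupp p -> (forall v, onY v -> p.@[v] = 0) -> p = 0.
Proof.
move=> hp hv; apply/mpolyP => m; rewrite mcoeff0 -(revexpK m).
have small e : std k 0 e -> all (fun a => a < k)%N e.
  by elim: e {1}0%N => //= a e IH r /andP[-> /IH].
apply: (@std_independent F k alpha alpha_inj n 0 (fun e => p@_(mnm_of n e))).
- by move=> e se ns; apply: hp; rewrite mnm_ofK.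
- move=> ys sy vy my; pose v (i : 'I_n) := nth 0 (rev ys) i.
  have vE : [seq v i | i <- enum 'I_n] = rev ys.
    apply: (@eq_from_nth _ 0); rewrite size_map size_enum_ord ?size_rev //.
    move=> i hi; rewrite (nth_map (Ordinal hi)) ?size_enum_ord //.
    by rewrite /v nth_enum_ord.
  have := @meval_ev F k n p v; rewrite vE revK => <-.
    by apply: hv; rewrite /onY vE revK vy -leqn0.
  move=> u hu i; have su : stdm u.
    by apply: contraLR hu => ns; rewrite mcoeff_msupp hp // eqxx.
  by apply: (allP (small _ su)); rewrite mem_rev; apply: map_f; rewrite mem_enum.
- exact: size_revexp.
Qed.

(** Supplied later by [groebner_list_divides]. *)
Hypothesis reducer : forall m, ~~ stdm m -> exists g u,
  [/\ J g, lead g u 1 & mdivides u m].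

(** A normal form modulo J; [B] records degree and order bounds on its monomials. *)
Definition reducible (B : 'X_{1..n} -> Prop) p :=
  exists s, [/\ stdsupp s, forall u, s@_u != 0 -> B u & J (p - s)].

Lemma reducible_lin B p : (forall m, m \in msupp p -> reducible B 'X_[m]) ->
  reducible B p.
Proof.
move=> h; rewrite [p]mpolyE big_seq.
apply: (big_ind (reducible B)) => [|p1 p2 [s1 [a1 b1 c1]] [s2 [a2 b2 c2]]|m /h[s [a b c]]].
- exists 0; split=> [m _|u|]; rewrite ?mcoeff0 ?eqxx // subrr; exact: in_ideal0.
- exists (s1 + s2); split; first exact: stdsuppD.
    move=> u; case: (eqVneq s1@_u 0) => [e1|/b1 //].
    by rewrite mcoeffD e1 add0r => /b2.
  by rewrite opprD addrACA; apply: in_idealD.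
- exists (p@_m *: s); split=> [u hu|u|]; rewrite ?mcoeffZ.
  + by rewrite a ?mulr0.
  + by rewrite mulf_eq0 negb_or => /andP[_ /b].
  + by rewrite -scalerBr; apply: in_idealZ.
Qed.

Lemma reducible_weaken (B B' : 'X_{1..n} -> Prop) p :
  (forall u, B u -> B' u) -> reducible B p -> reducible B' p.
Proof. by move=> h [s [a b c]]; exists s; split=> // u /b/h. Qed.

Lemma reducibleX d m : mdeg m = d ->
  reducible (fun u => mdeg u = d /\ neglex_le u m) 'X_[m].
Proof.
move: m; apply: (neglex_ind (P := fun m =>
  reducible (fun u => mdeg u = d /\ neglex_le u m) 'X_[m])) => m dm IH.
case: (boolP (stdm m)) => sm.
  exists 'X_[m]; split; last by rewrite subrr; apply: in_ideal0.
    by move=> u su; rewrite mcoeffX; case: eqP => // e; rewrite -e sm in su.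
  move=> u; rewrite mcoeffX; case: (m =P u) => [<-|]; last by rewrite eqxx.
  by rewrite /neglex_le eqxx.
have [g [u [Jg [gu gle] /forallP um]]] := reducer sm.
have em : m = (u + (m - u))%MM.
  by apply/mnmP => i; rewrite mnmDE mnmBE subnKC.
(* Taking the component of degree [mdeg u] preserves the leading term and keeps the reduction inside
   degree d, where [neglex_ind] applies. *)
pose g' := 'X_[m - u] * pihomog mdeg (mdeg u) g.
have Jg' : J g' by apply: in_idealMl; apply: J_pihomog.
have lg' : lead g' m 1.
  rewrite [X in lead _ X]em addmC -[X in lead _ _ X]mulr1; apply: leadM; first exact: leadX.
  split; first by rewrite mcoeff_pihomog eqxx.
  move=> w; rewrite mcoeff_msupp mcoeff_pihomog; case: ifP => _; last by rewrite eqxx.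
  by rewrite -mcoeff_msupp => /gle.
have hg' w : w \in msupp g' -> mdeg w = d.
  case/msuppM_le/allpairsP => -[a b] /= [].
  rewrite msuppX inE => /eqP -> hb ->.
  have /dhomogP/(_ _ hb) /= hb' := pihomogP mdeg (mdeg u) g.
  by rewrite mdegD hb' -dm {2}em mdegD addnC.
suff [s [a b c]] : reducible (fun u => mdeg u = d /\ neglex_le u m) ('X_[m] - g').
  exists s; split=> //; rewrite -(subrK g' 'X_[m]) -addrA [g' - s]addrC addrA.
  exact: in_idealD.
apply: reducible_lin => w hw.
have [lt dw] : neglex_lt w m /\ mdeg w = d.
  case: (eqVneq w m) => [e|ne].
    by move: hw; rewrite e mcoeff_msupp mcoeffB mcoeffX eqxx (proj1 lg') subrr eqxx.
  have wg : w \in msupp g'.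
    move: hw; rewrite !mcoeff_msupp mcoeffB mcoeffX [m == w]eq_sym (negPf ne) sub0r oppr_eq0.
    by [].
  split; last exact: hg'.
  by have := proj2 lg' _ wg; rewrite /neglex_le (negPf ne).
apply: reducible_weaken (IH _ dw lt) => z [-> hz]; split=> //.
by rewrite /neglex_le (neglex_le_lt_trans hz lt) orbT.
Qed.

(** The top component is reduced modulo J, and the difference in J is replaced by its lift vanishing
    on Y; what remains has lower degree. *)
Lemma std_interpolation d p : lowdeg d p -> exists s,
  [/\ stdsupp s, lowdeg d s & forall v, onY v -> (p - s).@[v] = 0].
Proof.
elim: d p => [|d IH] p hp.
  exists 0; split=> [m _|m _|v _]; rewrite ?mcoeff0 //.
  suff -> : p = 0 by rewrite subr0 meval0.
  by apply/mpolyP => m; rewrite mcoeff0 hp.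
have [|s0 [a b c]] := @reducible_lin (fun u => mdeg u = d) (pihomog mdeg d p).
  move=> m hm; apply: reducible_weaken (reducibleX (erefl (mdeg m))) => u [-> _].
  exact: dhomogP (pihomogP _ _ _) _ hm.
have [g [vg lg]] := J_lift d c.
have e0 : pihomog mdeg d s0 = s0.
  apply/mpolyP => m; rewrite mcoeff_pihomog; case: eqP => // ne.
  by apply/esym/eqP; apply/negPn/negP => /b.
rewrite raddfB /= pihomog_id e0 in lg.
have [|s1 [a1 b1 c1]] := IH (p - s0 - g).
  have -> : p - s0 - g = (p - pihomog mdeg d p) + (pihomog mdeg d p - s0 - g) by ring.
  apply: lowdegD => // m; rewrite leq_eqVlt => /orP[/eqP e|lt].
    by rewrite mcoeffB mcoeff_pihomog e eqxx subrr.
  rewrite mcoeffB mcoeff_pihomog hp //; case: eqP => [e|]; last by rewrite subr0.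
  by rewrite e ltnn in lt.
exists (s0 + s1); split; first exact: stdsuppD.
  move=> m hm; rewrite mcoeffD b1 1?ltnW // addr0.
  by apply/eqP/negPn/negP => /b e; rewrite e ltnn in hm.
move=> v yv; have := c1 v yv.
by rewrite !mevalB mevalD (vg _ yv) subr0 opprD addrA.
Qed.

(** If m were standard, reducing the lower terms would give a homogeneous standard t in J with the
    same coefficient at m. On Y, t agrees with a standard s' of lower degree, so t = s' by
    independence, which is impossible at m. *)
Lemma J_LM_nonstd_points f m : J f -> is_LM f m -> ~~ stdm m.
Proof.
move=> Jf [mf hle]; apply/negP => sm.
pose d := mdeg m; pose fd := pihomog mdeg d f; pose q := fd - f@_m *: 'X_[m].
have fdm : fd@_m = f@_m by rewrite mcoeff_pihomog eqxx.
have [|s [a b c]] := @reducible_lin (fun u => mdeg u = d /\ neglex_lt u m) q.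
  move=> u hu.
  have ne : u != m.
    apply: contraTneq hu => ->.
    by rewrite mcoeff_msupp mcoeffB mcoeffZ mcoeffX eqxx mulr1 fdm subrr eqxx.
  have : fd@_u != 0.
    by move: hu; rewrite mcoeff_msupp mcoeffB mcoeffZ mcoeffX [m == u]eq_sym (negPf ne) mulr0 subr0.
  rewrite mcoeff_pihomog; case: (mdeg u =P d) => [du|_]; last by rewrite eqxx.
  rewrite -mcoeff_msupp => /hle; rewrite /neglex_le (negPf ne) /= => lt.
  apply: reducible_weaken (reducibleX (erefl (mdeg u))) => w [-> hw]; split=> //.
  exact: neglex_le_lt_trans lt.
pose t := f@_m *: 'X_[m] + s.
have tm : t@_m = f@_m.
  rewrite mcoeffD mcoeffZ mcoeffX eqxx mulr1; apply/eqP; rewrite -subr_eq0 addrC addKr.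
  by apply/negPn/negP => /b[_]; rewrite neglex_ltnn.
have Jt : J t.
  have -> : t = fd - (q - s) by rewrite /t /q; ring.
  by apply: in_idealB => //; apply: J_pihomog.
have et : pihomog mdeg d t = t.
  apply/mpolyP => u; rewrite mcoeff_pihomog; case: eqP => // ne.
  rewrite mcoeffD mcoeffZ mcoeffX; case: eqP => [e|_]; first by rewrite -e in ne.
  by rewrite mulr0 add0r; apply/esym/eqP; apply/negPn/negP => /b[].
have [g [vg]] := J_lift d Jt; rewrite et => lg.
have [s' [a' b' c']] := std_interpolation lg.
have t0 : t - s' = 0.
  apply: stdsupp_vanish => [u hu|v yv].
    rewrite mcoeffB a' // mcoeffD a // mcoeffZ mcoeffX; case: eqP => [e|_].
      by rewrite -e sm in hu.
    by rewrite mulr0 addr0 subr0.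
  by have := c' v yv; rewrite !mevalB (vg _ yv) subr0.
move/(congr1 (mcoeff m)): t0; rewrite mcoeffB tm b' // subr0 mcoeff0 => f0.
by move: mf; rewrite mcoeff_msupp f0 eqxx.
Qed.

End Points.

(** * The Groebner basis *)

Section BaseChange.
Context (R K : fieldType) (f : {rmorphism R -> K}) (n : nat).

Lemma map_hcomp d j : map_mpoly f (hcomp R n d j) = hcomp K n d j.
Proof. by rewrite rmorph_sum; apply: eq_bigr => m _; apply: map_mpolyX. Qed.

Lemma map_esym d : map_mpoly f (Defs.esym R n d) = Defs.esym K n d.
Proof.
rewrite /Defs.esym !mesymE rmorph_sum; apply: eq_bigr => m _; apply: map_mpolyX.
Qed.

Lemma map_J_gens k g : g \in J_gens R n k -> map_mpoly f g \in J_gens K n k.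
Proof.
rewrite !mem_cat => /orP[] /mapP[j hj ->]; apply/orP; [left|right].
  by rewrite map_hcomp map_f.
by rewrite map_esym map_f.
Qed.

Lemma map_J k p : in_ideal_seq (J_gens R n k) p ->
  in_ideal_seq (J_gens K n k) (map_mpoly f p).
Proof.
case=> s [hs ->]; rewrite rmorph_sum; apply: in_ideal_sum => y ys _.
by rewrite rmorphM; apply: in_idealMl; apply: in_ideal_gen; apply: map_J_gens; apply: hs.
Qed.

Lemma map_is_LM (p : {mpoly R[n]}) m : is_LM p m -> is_LM (map_mpoly f p) m.
Proof.
have e := perm_mem (msupp_map_mpoly p (fmorph_inj f)).
by case=> h1 h2; split=> [|m']; rewrite e //; apply: h2.
Qed.

End BaseChange.

Lemma admissible_card (n k : nat) (S : {set 'I_n}) : (k <= n)%N ->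
  S \in admissible_sets n k -> (#|S| + k = n.+1)%N.
Proof. by move=> kn; rewrite mem_enum inE => /andP[/eqP -> _]; lia. Qed.

Section Groebner.
Context (R : fieldType) (n k : nat).
Hypotheses (k_gt0 : (0 < k)%N) (k_len : (k <= n)%N).
Local Notation J := (in_ideal_seq (J_gens R n k)).

Lemma groebner_listP g : g \in groebner_list R n k ->
  (exists2 i : 'I_n, g = hcomp R n k i.+1 & lead g (U_(i) *+ k)%MM 1) \/
  (exists S, [/\ S \in admissible_sets n k, g = demazure R (mrev (gammaS S)) &
     lead g (mrev (gammaS S)) 1]).
Proof.
rewrite mem_cat => /orP[] /mapP[].
  case=> [|i]; rewrite mem_iota // => hi ->; left.
  have hi' : (i < n)%N by lia.
  by exists (Ordinal hi') => //; apply: (lead_hcomp R k (Ordinal hi')).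
move=> S hS ->; right; exists S; split=> //.
exact: lead_demazure_gamma (admissible_card k_len hS).
Qed.

Lemma groebner_list_sub g : g \in groebner_list R n k -> J g.
Proof.
rewrite mem_cat => /orP[hg|/mapP[S hS ->]].
  by apply: in_ideal_gen; rewrite mem_cat hg.
exact: demazure_gamma_in_ideal (admissible_card k_len hS) k_gt0 k_len.
Qed.

Lemma groebner_list_divides m : ~~ std k 0 (revexp m) ->
  exists g u, [/\ g \in groebner_list R n k, lead g u 1 & mdivides u m].
Proof.
case/nonstd_divides => // [[i hi]|[S hS hd]].
  exists (hcomp R n k i.+1), (U_(i) *+ k)%MM; split.
  - rewrite mem_cat; apply/orP; left; apply: map_f; rewrite mem_iota.
    by have := ltn_ord i; lia.
  - exact: lead_hcomp.
  - apply/forallP => j; rewrite mulmnE mnm1E; case: (i =P j) => [<-|] //.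
    by rewrite mul1n.
exists (demazure R (mrev (gammaS S))), (mrev (gammaS S)); split=> //.
  by rewrite mem_cat; apply/orP; right; apply: map_f.
exact: lead_demazure_gamma (admissible_card k_len hS).
Qed.

End Groebner.

Lemma J_LM_nonstd (R : fieldType) (n k : nat) (f : {mpoly R[n]}) m :
  (0 < k)%N -> (k <= n)%N -> in_ideal_seq (J_gens R n k) f -> is_LM f m ->
  ~~ std k 0 (revexp m).
Proof.
move=> k0 kn Jf lm.
(* The field may be finite; over the fraction field of its polynomials the powers t^i are distinct,
   and leading monomials are unchanged. *)
pose K : fieldType := {fraction {poly R}}.
pose iota : {rmorphism R -> K} := @tofrac {poly R} \o polyC.
pose alpha (i : nat) : K := tofrac ('X^i).
have alpha_inj : injective alpha.
  move=> i j /eqP; rewrite tofrac_eq => /eqP/(congr1 (fun p : {poly R} => size p)).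
  by rewrite !size_polyXn => -[].
apply: (J_LM_nonstd_points alpha_inj k0 kn _ (map_J iota Jf) (map_is_LM iota lm)).
move=> u /(@groebner_list_divides K n k k0 kn)[g [w [hg lg hd]]].
by exists g, w; split=> //; apply: groebner_list_sub hg.
Qed.

Lemma mpolyX_divides (R : fieldType) (n : nat) (u m : 'X_{1..n}) : mdivides u m ->
  'X_[m] = 'X_[m - u] * 'X_[u] :> {mpoly R[n]}.
Proof.
move/forallP => h; rewrite -mpolyXD; congr 'X_[_]; apply/mnmP => i.
by rewrite mnmDE mnmBE subnK.
Qed.

Lemma groebner_list_is_groebner (R : fieldType) (n k : nat) :
  (0 < k)%N -> (k <= n)%N ->
  is_groebner (in_ideal_seq (J_gens R n k)) (groebner_list R n k).
Proof.
move=> k0 kn; split=> [g|p]; first exact: groebner_list_sub.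
split; apply: in_ideal_sub => q [f [m [hf [nz [lm ->]]]]].
  have := J_LM_nonstd k0 kn hf lm.
  case/(groebner_list_divides R k0 kn) => g [u [hg lg hd]].
  rewrite (mpolyX_divides R hd); apply: in_idealMl; apply: in_ideal_gen.
  by exists g, u; split=> //; split; [apply: lead_neq0 lg|split=> //; apply: lead_is_LM].
apply: in_ideal_gen; exists f, m; split; last by [].
exact: groebner_list_sub hf.
Qed.

(** The first part is the largest and equals k - p_0; p_0 > 0 because S avoids the last index. *)
Lemma gammaS_lt (n k : nat) (S : {set 'I_n}) i :
  (0 < k)%N -> (k <= n)%N -> S \in admissible_sets n k -> (mrev (gammaS S) i < k)%N.
Proof.
move=> k0 kn hS; have cS := admissible_card kn hS.
have [->//|g0] := posnP (mrev (gammaS S) i).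
have [a <-] := placed_codom (placed_gamma cS) g0; rewrite -/(glam a).
have S0 : (0 < #|S|)%N by apply: leq_ltn_trans (ltn_ord a).
have [h _] := glamE cS (Ordinal S0).
have := glam_dec cS (leq0n a : (Ordinal S0 <= a)%N); move/leq_ltn_trans; apply.
have : (0 < gpos (Ordinal S0))%N.
  rewrite /gpos; move: hS; rewrite mem_enum inE => /andP[_ /forallP h'].
  have := h' (enum_val (rev_ord (Ordinal S0))).
  by rewrite enum_valP /= subn_gt0.
by rewrite -(ltn_add2l (glam (Ordinal S0))) h addn0 /= addn0.
Qed.

Lemma gammaS_gt0 (n : nat) (S : {set 'I_n}) i :
  (0 < mrev (gammaS S) i)%N = (rev_ord i \in S).
Proof.
rewrite !mnmE; case: ifP => // iS.
rewrite -(enum_rankK_in iS iS); set a := enum_rank_in _ _.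
by rewrite card_below subn_gt0 ltnS leq_enum_val.
Qed.

Theorem mainTheorem6 (R : fieldType) (n k : nat) :
  (0 < k)%N -> (k <= n)%N ->
  is_groebner (in_ideal_seq (J_gens R n k)) (groebner_list R n k) /\
  ((k < n)%N -> is_minimal_groebner (in_ideal_seq (J_gens R n k)) (groebner_list R n k)).
Proof.
move=> k0 kn; have G := groebner_list_is_groebner R k0 kn; split=> // kltn.
split=> //; split=> [g hg|g g' m m' hg hg' ne lm lm'].
  have [u lu] : exists u, lead g u 1.
    by case: (groebner_listP k0 kn hg) => [[i _ h]|[S [_ _ h]]]; eexists; apply: h.
  split; first exact: lead_neq0 lu.
  by move=> m lm; rewrite -(is_LM_inj (lead_is_LM lu) lm); case: lu.
apply: contraNN ne => /forallP hd.
case: (groebner_listP k0 kn hg) => [[i eg lg]|[S [hS eg lg]]];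
case: (groebner_listP k0 kn hg') => [[i' eg' lg']|[S' [hS' eg' lg']]];
move: hd; rewrite -(is_LM_inj (lead_is_LM lg) lm) -(is_LM_inj (lead_is_LM lg') lm') => hd.
- have := hd i; rewrite !mulmnE !mnm1E eqxx; case: (i' =P i) => [e _|_].
    by rewrite eg eg' e.
  by rewrite mul1n mul0n leqNgt k0.
- by have := hd i; rewrite mulmnE mnm1E eqxx mul1n leqNgt (gammaS_lt _ k0 kn hS').
(* Here k < n enters: |S| is at least 2, so the monomial involves two variables and cannot divide a
   pure power. *)
- have cS := admissible_card kn hS; have : (1 < #|S|)%N by lia.
  case/card_gt1P => a [b [aS bS ab]].
  have hS1 c : c \in S -> c = rev_ord i'.
    move=> cS'; have := hd (rev_ord c); rewrite mulmnE mnm1E.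
    case: (i' =P rev_ord c) => [->|_]; first by rewrite rev_ordK.
    by rewrite mul0n leqn0 -[_ == _]negbK -lt0n gammaS_gt0 rev_ordK cS'.
  by rewrite (hS1 _ aS) (hS1 _ bS) eqxx in ab.
(* Divisibility gives an inclusion of supports, and both sets have n - k + 1 elements. *)
- suff -> : g = g' by [].
  rewrite eg eg'; congr (demazure R (mrev (gammaS _))); apply/eqP.
  rewrite eqEcard; apply/andP; split; last first.
    by have := admissible_card kn hS; have := admissible_card kn hS'; lia.
  apply/subsetP => c cS; rewrite -[c]rev_ordK -gammaS_gt0.
  by apply: leq_trans (hd (rev_ord c)); rewrite gammaS_gt0 rev_ordK.
Qed.
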